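(* Suppose demand is IID on $[0,\bar D]$ with common law $P$, the holding and shortage coefficients $h,p>0$ are constant over time, and ordering has zero fixed and per-unit costs and zero lead time. Let $g(s)=\mathbb E[h(s-D)^++p(D-s)^+]$ with $D\sim P$, and, from pooled IID observations $D^1,\ldots,D^M\sim P$, let $\widehat g_M(s)=M^{-1}\sum_{j=1}^M[h(s-D^j)^++p(D^j-s)^+]$ and $\widehat V_1(0)=T\min_{s\in[0,\bar D]}\widehat g_M(s)$. In either the backlog or lost-sales model with horizon $T$ started from $x_1=0$, $V_1^*(0)=T\min_{s\in[0,\bar D]}g(s)$, and for every $0<\eta<1$, with probability at least $1-\eta$, $$|\widehat V_1(0)-V_1^*(0)|\le T\max\{h,p\}\bar D\sqrt{\frac{\log(2/\eta)}{2M}}.$$ Thus, at bounded cost and demand scales, empty-start valuation to additive error $\epsilon$ with probability at least $1-\eta$ uses $O(T^2\epsilon^{-2}\log(1/\eta))$ pooled observations.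
   Context: Inventory model. Horizon $T$; $u^+=\max\{u,0\}$. Demands $D_1,\ldots,D_T$ are IID with law $P$ on $[0,\bar D]$, $\bar D>0$. Starting period $t$ with inventory $x_t$, the retailer chooses a post-order level $y_t\ge\max\{x_t,0\}$ before observing demand and incurs $h(y_t-D_t)^++p(D_t-y_t)^+$. The next state is $y_t-D_t$ in the backlog model and $(y_t-D_t)^+$ in the lost-sales model. Terminal salvage value is zero. Feasible policies use the information then available and may randomize; $V_1^*(x)$ is the infimum over feasible policies of the expected total cost over $T$ periods from initial inventory $x$. Pooled IID observations are fully observed demands. Logarithms are natural. *)

(* Defs.v *)
From HB Require Import structures.
From mathcomp Require Import all_boot all_order all_algebra.
From mathcomp Require Import all_classical all_reals all_analysis.

Set Implicit Arguments.
Unset Strict Implicit.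
Unset Printing Implicit Defensive.
Import Order.TTheory GRing.Theory Num.Theory.
Import numFieldNormedType.Exports.
Local Open Scope classical_set_scope.
Local Open Scope ring_scope.

(* Mutual independence of X 0, ..., X n.-1: the product rule over every
   subfamily J. *)
Definition mutually_independent (R : realType) (d : measure_display)
    (Omega : measurableType d) (Pr : probability Omega R) (n : nat)
    (X : nat -> {RV Pr >-> R}) : Prop :=
  forall (J : {set 'I_n}) (A : 'I_n -> set R), (forall i, measurable (A i)) ->
    Pr (\bigcap_(i in [set i | i \in J]) (X i @^-1` A i)) =
    (\prod_(i in J) Pr (X i @^-1` A i))%E.

(* X 0, ..., X n.-1 are IID with law P; the later terms of the sequence are
   irrelevant. *)
Definition iid (R : realType) (d : measure_display)
    (Omega : measurableType d) (Pr : probability Omega R) (n : nat)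
    (X : nat -> {RV Pr >-> R}) (P : probability (measurableTypeR R) R) : Prop :=
  mutually_independent n X /\
  forall (i : 'I_n) (A : set R), measurable A ->
    distribution Pr (X i) A = P A.

Definition with_probability_at_least (R : realType) (d : measure_display)
    (Omega : measurableType d) (Pr : probability Omega R) (q : R)
    (E : set Omega) : Prop :=
  measurable E /\ (q%:E <= Pr E)%E.

(* an infimum; minimum_attained, below, says that it is a minimum *)
Definition minimum (R : realType) (Dbar : R) (f : R -> R) : R :=
  inf [set f s | s in `[0, Dbar]].

Definition minimum_attained (R : realType) (Dbar : R) (f : R -> R) : Prop :=
  exists2 s, s \in `[0, Dbar] & forall s', s' \in `[0, Dbar] -> f s <= f s'.

Definition pos_part (R : realType) (u : R) : R := Num.max u 0.

Definition period_cost (R : realType) (h p y u : R) : R :=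
  h * pos_part (y - u) + p * pos_part (u - y).

Definition expected_period_cost (R : realType) (h p : R)
    (P : probability (measurableTypeR R) R) (s : R) : R :=
  fine 'E_P[fun u => period_cost h p s u].

Definition empirical_period_cost (R : realType) (h p : R) (M : nat)
    (sample : nat -> R) (s : R) : R :=
  M%:R^-1 * \sum_(j < M) period_cost h p s (sample j).

Variant dynamics := Backlog | LostSales.

Definition next_state (R : realType) (m : dynamics) (y u : R) : R :=
  match m with
  | Backlog => y - u
  | LostSales => pos_part (y - u)
  end.

(* What the retailer learns at the end of a period, apart from the next state:
   the demand itself, or nothing.  Under LostSales, the second case is that of
   censored demand: y and (y - u)^+ amount to y and the sales min(y, u).  Under
   Backlog the state y - u already reveals u, so both cases agree. *)
Variant information := DemandObserved | OnlyStateObserved.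

Definition signal (R : realType) (i : information) (u : R) : R :=
  match i with
  | DemandObserved => u
  | OnlyStateObserved => 0
  end.

(* (state, post-order level, signal) of the t past periods, latest first *)
Notation history R t :=
  (t.-tuple (measurableTypeR R * measurableTypeR R * measurableTypeR R)%type).

(* Randomization is carried by a seed drawn once, independently of the demands;
   its space and law are part of the policy, so fresh randomness in every period
   is covered.  [level t (z, H, x)] is the post-order level of period t (counted
   from 0) for seed z, history H and current inventory x. *)
Record policy (R : realType) := Policy {
  seed_display : measure_display ;
  seed : measurableType seed_display ;
  seed_law : probability seed R ;
  level : forall t : nat, (seed * history R t * measurableTypeR R)%type -> R ;
  level_measurable : forall t : nat, measurable_fun setT (@level t) ;
  level_feasible : forall (t : nat) (z : seed) (H : history R t) (x : R),
    Num.max x 0 <= level (z, H, x)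
}.

(* u t is the demand of period t; the result is the pair of the history and the
   inventory at the start of period t, so it depends on u 0, ..., u t.-1 only. *)
Fixpoint trajectory (R : realType) (m : dynamics) (i : information)
    (pi : policy R) (x : R) (z : seed pi) (u : nat -> R) (t : nat) :
    history R t * R :=
  match t with
  | 0 => ([tuple], x)
  | t'.+1 =>
      let (H, xt) := trajectory m i x z u t' in
      let y := level (z, H, xt) in
      ([tuple of (xt, y, signal i (u t')) :: H], next_state m y (u t'))
  end.

Definition order_up_to (R : realType) (m : dynamics) (i : information)
    (pi : policy R) (x : R) (z : seed pi) (u : nat -> R) (t : nat) : R :=
  let (H, xt) := trajectory m i x z u t in level (z, H, xt).

Definition total_cost (R : realType) (h p : R) (m : dynamics) (i : information)
    (T : nat) (pi : policy R) (x : R) (z : seed pi) (u : nat -> R) : R :=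
  \sum_(t < T) period_cost h p (order_up_to m i x z u t) (u t).

Definition expected_total_cost (R : realType) (h p : R) (m : dynamics)
    (i : information) (T : nat) (d : measure_display) (Omega : measurableType d)
    (Pr : probability Omega R) (demand : nat -> {RV Pr >-> R}) (x : R)
    (pi : policy R) : \bar R :=
  'E_(Pr \x seed_law pi)%E[fun w =>
    total_cost h p m i T x w.2 (fun t => demand t w.1)].

(* V_1^*(x): ordering is free and left-over stock has no terminal value, so the
   total cost has no further terms. *)
Definition optimal_cost (R : realType) (h p : R) (m : dynamics)
    (i : information) (T : nat) (d : measure_display) (Omega : measurableType d)
    (Pr : probability Omega R) (demand : nat -> {RV Pr >-> R}) (x : R) :
    \bar R :=
  ereal_inf [set c | exists pi : policy R,
    c = expected_total_cost h p m i T demand x pi].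

Definition empirical_cost (R : realType) (h p Dbar : R) (T M : nat)
    (sample : nat -> R) : R :=
  T%:R * minimum Dbar (empirical_period_cost h p M sample).

(* Main.v *)
Require Import Defs.
From HB Require Import structures.
From mathcomp Require Import all_boot all_order all_algebra.
From mathcomp Require Import all_classical all_reals all_analysis.
From mathcomp Require Import measurable_realfun ring lra zify.

Set Implicit Arguments.
Unset Strict Implicit.
Unset Printing Implicit Defensive.
Import Order.TTheory GRing.Theory Num.Theory.
Import numFieldNormedType.Exports.
Local Open Scope classical_set_scope.
Local Open Scope ring_scope.

(* Ordering is free, so every period is a newsvendor problem: a post-order level
   is a function of the seed and of past demands, hence independent of the
   current demand, and each period costs at least min g; ordering up to a
   minimizer of g attains this, since the state never exceeds that level.

   For the concentration, g and its empirical version are, up to the mesh of a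
   grid, the same linear functional of the true and of the empirical tail
   function, with coefficients of total size at most max(h, p) Dbar.  So the
   claim follows from the one-sided Dvoretzky-Kiefer-Wolfowitz inequality with
   sharp constant exp(- 2 M e^2), used in both directions.  That inequality is
   proved by a change of measure.  Moving mass to the extreme end of the line
   (replacing P by (P + a delta) / (1 + a)) gives the sample, at the first level
   of tail mass t exceeded by more than e, a likelihood ratio of at least
     ((1 + a / t)^(t + e) / (1 + a))^M,
   and a can be chosen, depending on e only, such that this is at least
   exp (2 M e^2) for every t. *)

(** * The exponential tilt *)

Lemma mean_value (R : realType) (f df : R -> R) (a b : R) : a < b ->
  (forall x, a <= x <= b -> is_derive x 1 f (df x)) ->
  exists2 c, a < c < b & f b - f a = df c * (b - a).
Proof.
move=> ab fdf; have [||c] := @MVT R f df a b ab.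
- by move=> x; rewrite in_itv/= => /andP[/ltW ax /ltW xb]; apply: fdf; rewrite ax.
- apply: continuous_in_subspaceT => x; rewrite inE/= in_itv/= => axb.
  by have := fdf _ axb => /@ex_derive/derivable1_diffP/differentiable_continuous.
- by rewrite in_itv/=; exists c.
Qed.

Lemma is_derive_affine (R : realType) (b k x : R) :
  is_derive x 1 (fun y : R => b + k * y) k.
Proof.
have H : is_derive x (1 : R) (cst b + k \*: id) (0 + k *: 1) by apply: is_deriveD.
by apply: (is_derive_eq H); rewrite add0r; exact: mulr1.
Qed.

Lemma is_derive_lincomb (R : realType) (f g : R -> R) (a b x df dg : R) :
  is_derive x 1 f df -> is_derive x 1 g dg ->
  is_derive x 1 (fun y => a * f y + b * g y) (a * df + b * dg).
Proof.
move=> ? ?; exact: (@is_deriveD _ _ _ (a \*: f) (b \*: g)).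
Qed.

Lemma is_derive_ln_affine (R : realType) (b k x : R) : 0 < b + k * x ->
  is_derive x 1 (fun y : R => ln (b + k * y)) (k / (b + k * x)).
Proof.
move=> bkx; have dl := is_derive1_ln bkx; have da := is_derive_affine b k x.
by have := @is_derive1_comp _ (@ln R) (fun y => b + k * y) x _ _ dl da; rewrite mulrC.
Qed.

Lemma is_derive_inv_affine (R : realType) (b k x : R) : b + k * x != 0 ->
  is_derive x 1 (fun y : R => (b + k * y)^-1) (- k / (b + k * x) ^+ 2).
Proof.
move=> bkx; have := @is_deriveV _ (fun y => b + k * y) x _ _ bkx (is_derive_affine b k x).
by move=> H; apply: (is_derive_eq H); rewrite -[LHS]/(_ * _) !mulNr mulrC.
Qed.

(** The hyperbola [a * x / (1 + k * x)] meets [ln (1 + x)] at [0] and is tangent to it at [z]. The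
    derivative of the difference has the sign of a quadratic with root [z], and its single other
    root [y] cannot account for all the sign changes that a negative value of the difference would
    force. *)
Lemma ln_ge_hyperbola (R : realType) (a k z x : R) : 0 < k -> 0 < z -> 0 < x ->
  ln (1 + z) = a * z / (1 + k * z) -> (1 + k * z) ^+ 2 = a * (1 + z) ->
  a * x / (1 + k * x) <= ln (1 + x).
Proof.
move=> k0 z0 x0 vz dz.
pose D (x : R) := ln (1 + x) + (a / k) * (1 + k * x)^-1.
have kx (u : R) : 0 <= u -> 0 < 1 + k * u.
  by move=> u0; have := mulr_ge0 (ltW k0) u0; lra.
(* The numerator [(1 + k * x) ^+ 2 - a * (1 + x)] of the derivative has product of roots
   [(1 - a) / k ^+ 2]; [y] is the root paired with [z]. *)
pose y := (1 - a) / (k ^+ 2 * z).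
pose q (x : R) := k ^+ 2 / ((1 + x) * (1 + k * x) ^+ 2).
pose dD (x : R) := q x * ((x - y) * (x - z)).
have D'E (u : R) : 0 <= u -> is_derive u 1 D (dD u).
  move=> u0; have u1 : 0 < 1 + u by lra.
  have ku := kx u u0.
  have l1 : 0 < 1 + 1 * u by lra.
  have := is_derive_lincomb 1 (a / k) (is_derive_ln_affine l1)
    (is_derive_inv_affine (lt0r_neq0 ku)).
  rewrite [X in is_derive _ _ X _](_ : _ = D); last first.
    by apply/funext => v; rewrite !mul1r.
  move/is_derive_eq; apply.
  rewrite /dD /q /y.
  have -> : a = (1 + k * z) ^+ 2 / (1 + z) by rewrite dz mulfK// gt_eqF//; lra.
  have z1 : 1 + z != 0 by rewrite gt_eqF//; lra.
  by field; rewrite ?z1 ?gt_eqF.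
have DE u : 0 <= u -> ln (1 + u) - a * u / (1 + k * u) = D u - a / k.
  by move=> u0; have := kx u u0; rewrite /D => ?; field; rewrite !gt_eqF.
have D0 : D 0 = a / k by rewrite /D addr0 ln1 mulr0 addr0 invr1 mulr1 add0r.
have Dz : D z = a / k.
  by apply/eqP; rewrite -subr_eq0 -(DE z (ltW z0)) vz subrr.
have q_gt0 u : 0 <= u -> 0 < q u.
  move=> u0; rewrite divr_gt0 ?exprn_gt0// mulr_gt0 ?exprn_gt0 ?kx//; lra.
have dDlt0 u : 0 <= u -> (dD u < 0) = ((u - y) * (u - z) < 0).
  by move=> u0; rewrite /dD pmulr_rlt0 ?q_gt0.
have dDgt0 u : 0 <= u -> (0 < dD u) = (0 < (u - y) * (u - z)).
  by move=> u0; rewrite /dD pmulr_rgt0 ?q_gt0.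
rewrite -subr_ge0 (DE x (ltW x0)) subr_ge0 leNgt; apply/negP => Dx.
(* A negative value below [z] gives points [c1 < c2 < z] of negative and of positive slope, hence
   [c2 < y < c1]. One above [z] gives [z < c1 < y], while Rolle's theorem on [[0, z]] puts the zero
   [y] below [z]. *)
have [xz|zx|xz] := ltgtP x z; last by move: Dx; rewrite xz Dz ltxx.
- have [|c1 /andP[c10 c1x] E1] := @mean_value _ D dD 0 x x0.
    by move=> u /andP[u0 _]; exact: D'E.
  have [|c2 /andP[c2x c2z] E2] := @mean_value _ D dD x z xz.
    by move=> u /andP[u0 _]; apply: D'E; lra.
  have : dD c1 < 0 by rewrite -(pmulr_llt0 _ (_ : 0 < x - 0)) -?E1 ?subr0//; lra.
  rewrite dDlt0; last lra.
  rewrite nmulr_llt0 => [c1y|]; last lra.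
  have : 0 < dD c2 by rewrite -(pmulr_lgt0 _ (_ : 0 < z - x)) -?E2 ?subr_gt0//; lra.
  rewrite dDgt0; last lra.
  rewrite nmulr_lgt0; lra.
- have [|c1 /andP[c10 c1x] E1] := @mean_value _ D dD z x zx.
    by move=> u /andP[u0 _]; apply: D'E; lra.
  have [|c2 /andP[c2x c2z] E2] := @mean_value _ D dD 0 z z0.
    by move=> u /andP[u0 _]; exact: D'E.
  have : dD c1 < 0 by rewrite -(pmulr_llt0 _ (_ : 0 < x - z)) -?E1 ?subr_gt0//; lra.
  rewrite dDlt0; last lra.
  rewrite pmulr_llt0 => [c1y|]; last lra.
  have /eqP : dD c2 * (z - 0) = 0 by rewrite -E2 Dz D0 subrr.
  rewrite subr0 mulf_eq0 (gt_eqF z0) orbF mulf_eq0 (gt_eqF (q_gt0 _ (ltW c2x))) /=.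
  by rewrite mulf_eq0 !subr_eq0 => /orP[/eqP|/eqP]; lra.
Qed.

(** As a function of [q], the right side minus the left side vanishes at [q = p] and is
    nonincreasing up to there, because [x * (1 - x) <= 1 / 4]; up to a constant it is [f]. *)
Lemma pinsker_bernoulli (R : realType) (p q : R) : 0 < q -> q < p -> p < 1 ->
  2 * (p - q) ^+ 2 <= p * ln (p / q) + (1 - p) * ln ((1 - p) / (1 - q)).
Proof.
move=> q0 qp p1.
pose f (x : R) := - (p * ln x) - (1 - p) * ln (1 - x) - 2 * (p - x) ^+ 2.
pose df (x : R) := (x - p) * ((x * (1 - x))^-1 - 4).
have dfE (u : R) : q <= u <= p -> is_derive u 1 f (df u).
  move=> /andP[qu up]; have l1 : 0 < 0 + 1 * u by lra.
  have l2 : 0 < 1 + (- 1) * u by lra.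
  have l3 := is_deriveX 2 (is_derive_affine p (- 1) u).
  have := is_derive_lincomb 1 (- 2) (is_derive_lincomb (- p) (- (1 - p))
    (is_derive_ln_affine l1) (is_derive_ln_affine l2)) l3.
  rewrite [X in is_derive _ _ X _](_ : _ = f); last first.
    by apply/funext => v; rewrite /f exprfctE !mul1r add0r !mulN1r; lra.
  move/is_derive_eq; apply.
  rewrite /df expr1 -[X in _ + _ * X = _]/(_ * _); field; lra.
have [c /andP[qc cp] E] := mean_value qp dfE.
have : df c <= 0.
  rewrite /df nmulr_rle0; last lra.
  have c0 : 0 < c * (1 - c) by apply: mulr_gt0; lra.
  by rewrite subr_ge0 -[leRHS]mul1r ler_pdivlMr//; have := sqr_ge0 (2 * c - 1); nra.
rewrite -(pmulr_lle0 _ (_ : 0 < p - q)) -?E ?subr_gt0// subr_le0 /f.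
rewrite !ln_div ?posrE; lra.
Qed.

Lemma ln1p_bounds (R : realType) (z : R) : 0 < z ->
  z < (1 + z) * ln (1 + z) /\ ln (1 + z) < z.
Proof.
move=> z0; have z1 : 0 < 1 + z by lra.
split.
  have : 1 + - ln (1 + z) < expR (- ln (1 + z)).
    by apply: expR_gt1Dx; rewrite oppr_eq0 gt_eqF// ln_gt0//; lra.
  rewrite expRN lnK ?posrE// -(ltr_pM2l z1) mulfV ?gt_eqF//; lra.
have : 1 + ln (1 + z) < expR (ln (1 + z)).
  by apply: expR_gt1Dx; rewrite gt_eqF// ln_gt0//; lra.
rewrite lnK ?posrE//; lra.
Qed.

(* 1 + z is the exponential tilt carrying the Bernoulli parameter (1 - k) / l to
   1 - k; the last equation says that e is the gap between the two. *)
Lemma tilt_gap_surjective (R : realType) (e : R) : 0 < e < 1 ->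
  exists z l k : R, [/\ 0 < z, l * z = (1 + z) * ln (1 + z), l = 1 + k * z,
    0 < k < 1 & (1 - k) * (l - 1) = e * l].
Proof.
move=> /andP[e0 e1].
pose l (z : R) := (1 + z) * ln (1 + z) / z.
pose k z := (l z - 1) / z.
have l_gt1 z : 0 < z -> 1 < l z.
  by move=> z0; rewrite /l ltr_pdivlMr// mul1r; have [] := ln1p_bounds z0.
have l_lt z : 0 < z -> l z < 1 + z.
  move=> z0; rewrite /l -mulrA gtr_pMr; last lra.
  by rewrite ltr_pdivrMr// mul1r; have [] := ln1p_bounds z0.
have k01 z : 0 < z -> 0 < k z < 1.
  move=> z0; have := l_gt1 z z0; have := l_lt z z0.
  by rewrite /k => ? ?; rewrite divr_gt0 ?ltr_pdivrMr// ?mul1r; lra.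
pose E z := (1 - k z) * (l z - 1) / l z.
suff [z z0 Ez] : exists2 z, 0 < z & E z = e.
  have zn0 : z != 0 by rewrite gt_eqF.
  exists z, (l z), (k z); split; rewrite ?k01//.
  - by rewrite /l divfK.
  - by rewrite /k divfK//; lra.
  - by rewrite -Ez /E divfK// gt_eqF//; have := l_gt1 z z0; lra.
(* The [5] is [4 + 1]: at [b = expR y - 1] one gets [k b <= 4 / y] and [(1 - k b) / l b <= 1 / y],
   so [1 - E b <= 5 / y = 1 - e]. *)
pose y : R := 5 / (1 - e).
have y5 : 5 < y by rewrite /y ltr_pdivlMr; nra.
pose b := expR y - 1.
have b2 : y ^+ 2 / 2 <= b.
  by rewrite /b; have := @expR_ge1Dxn R y 1; rewrite (_ : 2`! = 2)// => /(_ _); lra.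
have by_ : y < b by rewrite expr2 in b2; nra.
have b0 : 0 < b by lra.
have Ee : E e <= e.
  have := l_gt1 _ e0; have := l_lt _ e0; have /andP[] := k01 _ e0.
  rewrite /E => k0 k1 l1 l2.
  rewrite ler_pdivrMr; last lra.
  by apply: (@le_trans _ _ (1 * (l e - 1))); [rewrite ler_pM2r; lra|nra].
have Eb : e <= E b.
  have lb : l b = expR y * y / b by rewrite /l /b subrKC expRK.
  have expE : expR y = 1 + b by rewrite /b subrKC.
  have yl : y <= l b.
    by rewrite lb ler_pdivlMr// expE mulrDl mul1r mulrC; lra.
  have ly : l b <= 2 * y.
    by rewrite lb ler_pdivrMr// expE; nra.
  have kb : k b <= 4 / y.
    rewrite /k ler_pdivrMr// mulrAC ler_pdivlMr; last lra.
    rewrite expr2 in b2; nra.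
  have lV : (l b)^-1 <= y^-1 by rewrite lef_pV2 ?posrE//; lra.
  rewrite /E mulrBr mulr1 mulrBl mulfK; last by rewrite gt_eqF//; lra.
  have ye : y^-1 = (1 - e) / 5 by rewrite /y invf_div.
  have /andP[kb0 kb1] := k01 _ b0.
  have : (1 - k b) / l b <= 1 * y^-1.
    by apply: ler_pM; rewrite ?invr_ge0; lra.
  lra.
have lc z : 0 < z -> {for z, continuous l}.
  move=> z0; apply: continuousM; last first.
    by apply: continuousV; [rewrite gt_eqF|exact: cvg_id].
  apply: continuousM; first by apply: cvgD; [exact: cvg_cst|exact: cvg_id].
  apply: continuous_comp; first by apply: cvgD; [exact: cvg_cst|exact: cvg_id].
  by apply: continuous_ln; lra.
have kc z : 0 < z -> {for z, continuous k}.
  move=> z0; apply: continuousM; last first.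
    by apply: continuousV; [rewrite gt_eqF|exact: cvg_id].
  by apply: cvgB; [exact: lc|exact: cvg_cst].
have Ec z : 0 < z -> {for z, continuous E}.
  move=> z0; have lz := l_gt1 z z0; apply: continuousM; last first.
    by apply: continuousV; [rewrite gt_eqF//; lra|exact: lc].
  apply: continuousM; first by apply: cvgB; [exact: cvg_cst|exact: kc].
  by apply: cvgB; [exact: lc|exact: cvg_cst].
have [|||z zeb Ez] := @IVT R E e b e.
- lra.
- apply: continuous_in_subspaceT => z; rewrite inE/= in_itv/= => /andP[ez _].
  by apply: Ec; lra.
- by rewrite ge_min le_max Ee Eb orbT.
- by exists z => //; move: zeb; rewrite in_itv/=; lra.
Qed.

(** With [p = 1 - k], [q = p / l] and [h = q * z], the case [t = q] is Pinsker's inequality for [p]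
    and [q], whose difference is [e]. That case is the worst one: as [e = k * h], the product of
    [t + e] with the hyperbola at [h / t] is the constant [p * ln (1 + z)]. *)
Lemma dkw_tilt (R : realType) (e : R) : 0 < e < 1 ->
  exists2 h, 0 < h & forall t, 0 < t ->
    ln (1 + h) + 2 * e ^+ 2 <= (t + e) * ln (1 + h / t).
Proof.
move=> /tilt_gap_surjective[z [l [k [z0 lnE kz /andP[k0 k1] pq]]]].
have l1 : 1 < l by rewrite kz ltrDl mulr_gt0.
pose p := 1 - k; pose q := p / l; pose h := q * z.
have p0 : 0 < p by rewrite /p; lra.
have l0 : 0 < l by lra.
have q0 : 0 < q by rewrite divr_gt0.
have h0 : 0 < h by rewrite mulr_gt0.
have ql : q * l = p by rewrite /q divfK ?gt_eqF.
have eE : e = p - q.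
  by apply: (mulIf (lt0r_neq0 l0)); rewrite -pq [RHS]mulrBl ql /p; lra.
have qp : q < p by rewrite /q gtr_pMr// invf_lt1.
have zh : 1 + z = l * (1 + h).
  rewrite /h /q mulrDr mulr1 mulrA mulrCA mulfV ?gt_eqF// mulr1 /p; lra.
have kh : (1 - p) / (1 - q) = (1 + h)^-1.
  have -> : 1 - q = (1 + h) * k.
    rewrite mulrDl mul1r /h -mulrA [z * k]mulrC.
    have -> : k * z = l - 1 by lra.
    rewrite /q mulrBr mulr1 divfK ?gt_eqF// /p; lra.
  by rewrite /p; field; rewrite !gt_eqF//; lra.
have kl : ln (1 + h) + 2 * e ^+ 2 <= p * ln (1 + z).
  have h1 : 0 < 1 + h by lra.
  have := @pinsker_bernoulli R p q q0 qp _.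
  have -> : p / q = l by rewrite -ql; field; rewrite gt_eqF.
  rewrite kh -eE zh lnM ?posrE// lnV ?posrE//.
  by move=> /(_ _); rewrite /p; lra.
exists h => // t t0; apply: (le_trans kl).
have ht0 : 0 < h / t by rewrite divr_gt0.
(* The coefficient of the hyperbola is dictated by tangency at [z], since [1 + k * z = l]. *)
have := @ln_ge_hyperbola R (l ^+ 2 / (1 + z)) k z (h / t) k0 z0 ht0.
have z1 : 1 + z != 0 by rewrite gt_eqF//; lra.
rewrite -kz divfK// => /(_ _ erefl) H.
have {H} : l ^+ 2 / (1 + z) * (h / t) / (1 + k * (h / t)) <= ln (1 + h / t).
  by apply: H; rewrite -[LHS](mulKf z1) -lnE; field; rewrite z1 gt_eqF.
rewrite -(ler_pM2l (_ : 0 < t + e)); last by rewrite addr_gt0//; lra.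
apply: le_trans.
have keh : e = k * h.
  rewrite eE /h mulrCA [k * z](_ : _ = l - 1); last lra.
  by rewrite mulrBr mulr1 /q divfK ?gt_eqF.
have kht : 0 < t + k * h by rewrite -keh; lra.
rewrite keh -[ln (1 + z)](mulKf z1) -lnE /h /q le_eqVlt; apply/orP; left; apply/eqP.
by field; rewrite z1 !gt_eqF// addr_gt0 ?mulr_gt0.
Qed.

(** * A sharp one-sided inequality for finite samples *)

Section finite_dkw.
Variables (R : realType) (K M : nat).
Local Notation config := {ffun 'I_M -> 'I_K.+1}.
Implicit Types (pi : 'I_K.+1 -> R) (f : config).

Definition upper_tail pi (k : nat) : R := \sum_(i < K.+1 | (k < i)%N) pi i.

Definition exceedances (k : nat) f : nat := \sum_(j < M) (k < f j)%N.

(** Mapping each observation of an independent sample through [tau] gives an independent sample with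
    the image masses; the proof groups configurations by their image. *)
Lemma sum_prod_comp pi (tau : 'I_K.+1 -> 'I_K.+1) (phi : pred config) :
  \sum_(f : config | phi [ffun j => tau (f j)]) \prod_(j < M) pi (f j) =
  \sum_(g : config | phi g) \prod_(j < M) \sum_(i | tau i == g j) pi i.
Proof.
rewrite (partition_big (fun f : config => [ffun j => tau (f j)]) phi)//=.
apply: eq_bigr => g phig; rewrite bigA_distr_big_dep.
apply: eq_bigl => f; apply/andP/familyP => [[_ /eqP <-] j|tg].
  by rewrite unfold_in /= ffunE.
have -> : [ffun j => tau (f j)] = g.
  by apply/ffunP => j; rewrite ffunE; apply/eqP; exact: tg.
by rewrite eqxx.
Qed.

(* tilt pi h moves mass h to the deepest class: restricted to what is known of
   a sample once everything beyond level k is merged, its likelihood ratio is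
   ((1 + h / q) ^ N) / (1 + h) ^ M with N the number of exceedances of k *)
Definition tilt pi (h : R) (i : 'I_K.+1) : R := (pi i + h *+ (i == ord_max)) / (1 + h).

Definition merge_above (k : 'I_K) (i : 'I_K.+1) : 'I_K.+1 := inord (minn i k.+1).

Lemma merge_aboveE (k : 'I_K) i : merge_above k i = minn i k.+1 :> nat.
Proof. by rewrite inordK// ltnS geq_min orbC ltn_ord. Qed.

Lemma merge_above_gt (k l : 'I_K) i : (l <= k)%N -> (l < merge_above k i)%N = (l < i)%N.
Proof. by move=> lk; rewrite merge_aboveE leq_min ltnS lk andbT. Qed.

Lemma sum_merge_above pi (k : 'I_K) (i : 'I_K.+1) :
  \sum_(i' | merge_above k i' == i) pi i' =
  if (i <= k)%N then pi i else if i == k.+1 :> nat then upper_tail pi k else 0.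
Proof.
have E i' : (merge_above k i' == i) = (minn i' k.+1 == i).
  by rewrite -merge_aboveE.
case: ifPn => [ik|]; last (rewrite -ltnNge => ki; case: ifPn => [/eqP ik|ik]).
- rewrite (big_pred1 i)// => i'; rewrite E /= -(val_eqE i' i).
  by apply/eqP/eqP => /=; lia.
- apply: eq_bigl => i'; rewrite E ik; by apply/eqP/idP; lia.
- rewrite big_pred0// => i'; rewrite E; apply/eqP; move/eqP: ik.
  have := ltn_ord i'; have := ltn_ord k; lia.
Qed.

Lemma upper_tail_tilt pi h (k : 'I_K) :
  upper_tail (tilt pi h) k = (upper_tail pi k + h) / (1 + h).
Proof.
rewrite /upper_tail -mulr_suml big_split/=; congr ((_ + _) / _).
rewrite (bigD1 ord_max)//= eqxx big1 ?addr0// => i /andP[_ /negbTE ->].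
by rewrite mulr0n.
Qed.

(** The event splits according to the first level crossed. On each piece the tilted probability is
    at least [expR (2 * M%:R * e ^+ 2)] times the original one, and the tilted probabilities of the
    disjoint pieces add up to at most [1]. *)
Lemma finite_dkw pi (e : R) : (0 < M)%N -> 0 < e < 1 ->
  (forall i, 0 <= pi i) -> \sum_i pi i = 1 ->
  \sum_(f : config | [exists k : 'I_K, M%:R * (upper_tail pi k + e) <= (exceedances k f)%:R])
    \prod_(j < M) pi (f j) <= expR (- (2 * M%:R * e ^+ 2)).
Proof.
move=> M0 e01 pi0 pi1; have [h h0 hP] := dkw_tilt e01.
have h1 : 0 < 1 + h by lra.
pose cross (k : nat) f := M%:R * (upper_tail pi k + e) <= (exceedances k f)%:R.
(* Whether [k] is the first crossed level depends only on exceedances of levels up to [k], so it can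
   be read off the sample with all classes above [k] merged. *)
pose first (k : 'I_K) f := cross k f && [forall l : 'I_K, (l < k)%N ==> ~~ cross l f].
have crossE f : [exists k : 'I_K, cross k f] = [exists k : 'I_K, first k f].
  apply/existsP/existsP => [[k ck]|[k /andP[ck _]]]; last by exists k.
  have [m cm mmin] := @arg_minnP _ k (fun k : 'I_K => cross k f) (fun k => k : nat) ck.
  exists m; rewrite /first cm; apply/forallP => l; apply/implyP => lm.
  by apply/negP => /mmin; rewrite leqNgt lm.
have merge_exc (k l : 'I_K) f : (l <= k)%N ->
    exceedances l [ffun j => merge_above k (f j)] = exceedances l f.
  by move=> lk; apply: eq_bigr => j _; rewrite ffunE merge_above_gt.
have first_merge (k : 'I_K) f : first k [ffun j => merge_above k (f j)] = first k f.
  rewrite /first /cross merge_exc//; congr (_ && _); apply: eq_forallb => l.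
  by case: ltnP => //= lk; rewrite merge_exc// ltnW.
have split_first (pi' : 'I_K.+1 -> R) :
    \sum_(f : config | [exists k : 'I_K, cross k f]) \prod_(j < M) pi' (f j) =
    \sum_(k < K) \sum_(f : config | first k f) \prod_(j < M) pi' (f j).
  rewrite (exchange_big_dep (fun f : config => [exists k : 'I_K, cross k f]))/=; last first.
    by move=> k f _ /andP[ck _]; apply/existsP; exists k.
  apply: eq_bigr => f; rewrite crossE => /existsP[k fk].
  rewrite (big_pred1 k)// => l; apply/idP/eqP => [fl|->//].
  apply/val_inj; apply/eqP; rewrite eqn_leq; apply/andP; split; rewrite leqNgt; apply/negP => lk.
    by move: fl => /andP[_ /forallP/(_ k)]; rewrite lk /=; move: fk => /andP[->].
  by move: fk => /andP[_ /forallP/(_ l)]; rewrite lk /=; move: fl => /andP[->].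
have tilt0 i : 0 <= tilt pi h i.
  by rewrite divr_ge0 ?addr_ge0 ?mulrn_wge0//; lra.
have tilt1 : \sum_i tilt pi h i = 1.
  rewrite -mulr_suml big_split/= pi1 (bigD1 ord_max)//= eqxx big1 ?addr0 ?mulfV ?gt_eqF//.
  by move=> i /negbTE ->; rewrite mulr0n.
apply: (@le_trans _ _ (expR (- (2 * M%:R * e ^+ 2)) *
    \sum_(f : config | [exists k : 'I_K, cross k f]) \prod_(j < M) tilt pi h (f j))); last first.
  rewrite ler_piMr ?expR_ge0//.
  apply: (@le_trans _ _ (\sum_(f : config) \prod_(j < M) tilt pi h (f j))).
    rewrite [leRHS](bigID (fun f : config => [exists k : 'I_K, cross k f]))/= lerDl.
    by apply: sumr_ge0 => f _; apply: prodr_ge0.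
  by rewrite -(bigA_distr_bigA (fun=> tilt pi h))/= tilt1 prodr_const expr1n.
rewrite [leLHS]split_first [in leRHS]split_first mulr_sumr; apply: ler_sum => k _.
rewrite !(eq_bigl _ _ (fun f => esym (first_merge k f))) !sum_prod_comp mulr_sumr.
apply: ler_sum => g /andP[ck _].
have merge_ge0 i : 0 <= \sum_(i' | merge_above k i' == i) pi i' by apply: sumr_ge0.
have q_ge0 : 0 <= upper_tail pi k by apply: sumr_ge0.
have M_gt0 : 0 < M%:R :> R by rewrite ltr0n.
(* Without tail mass the ratio [h / q] is meaningless, but a crossing then needs an observation
   above [k], where the mass is zero, so the left product vanishes. *)
have [q0|q0] := eqVneq (upper_tail pi k) 0.
  have [j kj] : exists j, (k < g j)%N.
    apply/existsP; rewrite -[X in is_true X]negbK negb_exists; apply/negP => /forallP ng.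
    move: ck; rewrite /cross q0 add0r [exceedances _ _]big1; last first.
      by move=> j _; rewrite (negbTE (ng j)).
    by rewrite leNgt mulr_gt0//; case/andP: e01.
  rewrite (bigD1 j)//= sum_merge_above leqNgt kj/= q0 if_same mul0r.
  by rewrite mulr_ge0 ?expR_ge0//; apply: prodr_ge0 => i _; apply: sumr_ge0.
have q_gt0 : 0 < upper_tail pi k by rewrite lt_def q0.
set q := upper_tail pi k in q0 q_gt0 ck *.
have hq0 : 0 < h / q by rewrite divr_gt0.
have tiltE j : \sum_(i | merge_above k i == g j) tilt pi h i =
    (\sum_(i | merge_above k i == g j) pi i) * ((1 + h / q) ^+ (k < g j)%N / (1 + h)).
  rewrite !sum_merge_above ltnNge; case: ifPn => gk /=.
    rewrite /tilt mul1r (_ : g j == ord_max = false) ?addr0//.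
    by apply/negbTE; rewrite -val_eqE/= neq_ltn (leq_ltn_trans gk)//.
  case: ifPn => _; last by rewrite mul0r.
  by rewrite upper_tail_tilt -/q; field; rewrite q0 gt_eqF.
rewrite (eq_bigr _ (fun j _ => tiltE j)) big_split/= mulrCA ler_peMr ?prodr_ge0//.
rewrite big_split/= prodr_const card_ord -(expr_sum (1 + h / q)) -/(exceedances k g).
rewrite exprVn mulrA ler_pdivlMr ?exprn_gt0// mul1r expRN.
rewrite mulrC ler_pdivlMr ?expR_gt0//.
(* In logarithms the claim is [M] times [hP] at [t = q], since a crossing means at least
   [M%:R * (q + e)] exceedances. *)
rewrite -[X in X ^+ M](@lnK R) ?posrE// -[X in _ <= X ^+ _](@lnK R) ?posrE; last first.
  by rewrite addr_gt0.
rewrite -!expRM_natl -expRD ler_expR.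
apply: (@le_trans _ _ (M%:R * (q + e) * ln (1 + h / q))).
  by rewrite -mulrA; have := hP q q_gt0; rewrite -(ler_pM2l M_gt0); lra.
by rewrite ler_wpM2r// ln_ge0//; lra.
Qed.

End finite_dkw.

(** * Empirical tail frequencies *)

Lemma measure_finite_cover (R : realType) (d : measure_display) (T : measurableType d)
    (mu : {measure set T -> \bar R}) (I : finType) (p : pred I) (F : I -> set T)
    (A : set T) : measurable A -> (forall i, p i -> measurable (F i)) ->
  (forall w, A w -> exists2 i, p i & F i w) ->
  (mu A <= \sum_(i | p i) mu (F i))%E.
Proof.
move=> mA mF AF; rewrite (bigfs _ (index_enum_uniq I))/=; last first.
  by move=> i _; rewrite mem_index_enum.
by apply: content_sub_fsum => // w /AF[i pi Fi]; exists i.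
Qed.

Lemma measure_finite_partition (R : realType) (d : measure_display) (T : measurableType d)
    (mu : {measure set T -> \bar R}) (I : finType) (p : pred I) (c : T -> I) :
  (forall i, measurable (c @^-1` [set i])) ->
  mu [set w | p (c w)] = (\sum_(i | p i) mu (c @^-1` [set i]))%E.
Proof.
move=> mc; rewrite (bigfs _ (index_enum_uniq I))/=; last first.
  by move=> i _; rewrite mem_index_enum.
rewrite -measure_fin_bigcup//; last first.
  by move=> i j _ _ [w [/= <- <-]].
by congr (mu _); apply/seteqP; split => [w pw|w [i pi /= ->]//]; exists (c w).
Qed.

Section empirical_process.
Variables (R : realType) (K M : nat) (d : measure_display) (Omega : measurableType d).
Variables (Pr : probability Omega R) (X : nat -> {RV Pr >-> R}).
Variable P : probability (measurableTypeR R) R.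
Variable c : R -> 'I_K.+1.
Hypothesis mc : forall i, measurable (c @^-1` [set i] : set (measurableTypeR R)).
Hypothesis iidX : iid M X P.

Definition class_mass (i : 'I_K.+1) : R := fine (P (c @^-1` [set i])).

Lemma class_massE i : (class_mass i)%:E = P (c @^-1` [set i]).
Proof. by rewrite fineK// fin_num_measure//; exact: mc. Qed.

Lemma class_mass_ge0 i : 0 <= class_mass i. Proof. exact: fine_ge0. Qed.

Lemma upper_tail_class (k : nat) :
  (upper_tail class_mass k)%:E = P [set u | (k < c u)%N].
Proof.
rewrite (@measure_finite_partition _ _ _ P _ (fun i : 'I_K.+1 => (k < i)%N))//.
by rewrite /upper_tail -sumEFin; apply: eq_bigr => i _; rewrite class_massE.
Qed.

Lemma sum_class_mass : \sum_i class_mass i = 1.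
Proof.
apply: EFin_inj; rewrite -sumEFin (eq_bigr _ (fun i _ => class_massE i)).
rewrite -(@measure_finite_partition _ _ _ P _ predT)// -(probability_setT P).
by congr (P _); apply/seteqP.
Qed.

Let config := {ffun 'I_M -> 'I_K.+1}.
Definition sample_config (w : Omega) : config := [ffun j : 'I_M => c (X j w)].

Lemma sample_config_preimage (f : config) :
  sample_config @^-1` [set f] =
  \bigcap_(j in [set j | j \in [set: 'I_M]%SET]) (X j @^-1` (c @^-1` [set f j])).
Proof.
apply/seteqP; split => [w /= <- j _|w /= H]; first by rewrite /= ffunE.
by apply/ffunP => j; rewrite ffunE; apply: H; rewrite /= inE.
Qed.

Lemma measurable_sample_config_preimage (f : config) :
  measurable (sample_config @^-1` [set f]).
Proof.
rewrite sample_config_preimage; apply: fin_bigcap_measurable => // j _.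
by have := measurable_funPTI (X j) (mc (f j)).
Qed.

Lemma measurable_sample_config (p : pred config) :
  measurable [set w | p (sample_config w)].
Proof.
have -> : [set w | p (sample_config w)] =
    \bigcup_(f in [set` p]) (sample_config @^-1` [set f]).
  by apply/seteqP; split => [w pw|w [i pi /= ->]//]; exists (sample_config w).
by apply: fin_bigcup_measurable => // f _; exact: measurable_sample_config_preimage.
Qed.

Lemma sample_config_law (f : config) :
  Pr (sample_config @^-1` [set f]) = (\prod_(j < M) class_mass (f j))%:E.
Proof.
have [ind law] := iidX.
rewrite sample_config_preimage (ind [set: 'I_M]%SET (fun j => c @^-1` [set f j])); last first.
  by move=> j; exact: mc.
rewrite (eq_bigl predT) => [|j]; last by rewrite inE.
rewrite -prodEFin; apply: eq_bigr => j _; by rewrite class_massE -(law j)//; exact: mc.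
Qed.

Lemma empirical_exceedance (e : R) : (0 < M)%N -> 0 < e < 1 ->
  (Pr [set w | [exists k : 'I_K, (M%:R * (upper_tail class_mass k + e) <=
    (exceedances k (sample_config w))%:R)%R]] <= (expR (- (2 * M%:R * e ^+ 2)))%:E)%E.
Proof.
move=> M0 e01.
rewrite (@measure_finite_partition _ _ _ Pr _ (fun f : config =>
  [exists k : 'I_K, M%:R * (upper_tail class_mass k + e) <= (exceedances k f)%:R])).
  rewrite (eq_bigr _ (fun f _ => sample_config_law f)) sumEFin lee_fin.
  exact: finite_dkw class_mass_ge0 sum_class_mass.
exact: measurable_sample_config_preimage.
Qed.

End empirical_process.

(** * Discretization of the demand *)

(** This symmetry turns the Lipschitz bound in the demand into one in the order level. *)
Lemma period_costC (R : realType) (h p y u : R) : period_cost h p y u = period_cost p h u y.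
Proof. by rewrite /period_cost addrC. Qed.

Lemma pos_part_le_dist (R : realType) (a b : R) : pos_part a <= pos_part b + pos_part (a - b).
Proof.
rewrite /pos_part; case: (leP a 0); case: (leP b 0); case: (leP (a - b) 0); lra.
Qed.

(** The distance of [u] and [v] is the sum of two opposite positive parts, one weighted by [h] and
    the other by [p]; hence the slope is the maximum of the two coefficients and not their sum. *)
Lemma period_cost_le (R : realType) (h p y u v : R) : 0 < h -> 0 < p ->
  period_cost h p y u <= period_cost h p y v + Num.max h p * `|u - v|.
Proof.
move=> h0 p0.
have hm : h <= Num.max h p by rewrite le_max lexx.
have pm : p <= Num.max h p by rewrite le_max lexx orbT.
rewrite /period_cost.
have H1 := pos_part_le_dist (y - u) (y - v).
have H2 := pos_part_le_dist (u - y) (v - y).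
have -> : `|u - v| = pos_part (y - u - (y - v)) + pos_part (u - y - (v - y)).
  rewrite /pos_part; case: (ger0P (u - v)); case: (leP (y - u - (y - v)) 0);
    case: (leP (u - y - (v - y)) 0); lra.
have P1 : 0 <= pos_part (y - u - (y - v)) by rewrite le_max lexx orbT.
have P2 : 0 <= pos_part (u - y - (v - y)) by rewrite le_max lexx orbT.
move: H1 H2 P1 P2; set a := pos_part (y - u); set b := pos_part (u - y).
set a' := pos_part (y - u - _); set b' := pos_part (u - y - _) => H1 H2 P1 P2.
have := ler_wpM2l (ltW h0) H1; have := ler_wpM2l (ltW p0) H2.
have := ler_wpM2r P1 hm; have := ler_wpM2r P2 pm; lra.
Qed.

Lemma period_cost_lipschitz (R : realType) (h p y u v : R) : 0 < h -> 0 < p ->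
  `|period_cost h p y u - period_cost h p y v| <= Num.max h p * `|u - v|.
Proof.
move=> h0 p0; have H1 := period_cost_le y u v h0 p0.
by have := period_cost_le y v u h0 p0; rewrite distrC ler_norml; lra.
Qed.

Lemma period_cost_ge0 (R : realType) (h p y u : R) : 0 < h -> 0 < p ->
  0 <= period_cost h p y u.
Proof.
by move=> h0 p0; rewrite addr_ge0// mulr_ge0 ?(ltW h0) ?(ltW p0)// le_max lexx orbT.
Qed.

Section grid.
Variables (R : realType) (K : nat) (Dbar : R).
Hypotheses (Dbar_gt0 : 0 < Dbar) (K_gt0 : (0 < K)%N).

Definition mesh : R := Dbar / K%:R.

Lemma mesh_gt0 : 0 < mesh. Proof. by rewrite divr_gt0 ?ltr0n. Qed.

(** Rounding up to the grid. When none of the first [K] grid points reaches [u], [find] returns the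
    length [K], so the top class collects everything above the last of them. *)
Definition grid_class (u : R) : 'I_K.+1 :=
  inord (find (fun k => u <= k%:R * mesh) (iota 0 K)).

Lemma grid_class_gt (k : nat) (u : R) : (k < K)%N ->
  (k < grid_class u)%N = (k%:R * mesh < u).
Proof.
move=> kK; set a := fun k => u <= k%:R * mesh.
have fK : (find a (iota 0 K) <= K)%N by rewrite -[leqRHS](size_iota 0) find_size.
rewrite inordK ?ltnS//; apply/idP/idP => [/(before_find 0)|].
  by rewrite nth_iota// add0n /a leNgt => /negbFE.
apply: contraTT; rewrite -leqNgt -leNgt => fk.
have hs : has a (iota 0 K) by rewrite has_find size_iota (leq_ltn_trans fk).
have := nth_find 0 hs; rewrite nth_iota ?(leq_ltn_trans fk)// add0n /a => /le_trans; apply.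
by rewrite ler_pM2r ?mesh_gt0// ler_nat.
Qed.

Lemma grid_class_approx (u : R) : 0 <= u <= Dbar ->
  `|u - (grid_class u)%:R * mesh| <= mesh.
Proof.
move=> /andP[u0 uD]; have d0 := mesh_gt0.
have up : u <= (grid_class u)%:R * mesh.
  have := ltn_ord (grid_class u); rewrite ltnS leq_eqVlt => /orP[/eqP ->|iK].
    by rewrite /mesh mulrC divfK// pnatr_eq0 -lt0n.
  by rewrite leNgt -grid_class_gt// ltnn.
have lo : ((grid_class u)%:R - 1) * mesh <= u.
  case E : (nat_of_ord (grid_class u)) => [|k]; first by rewrite sub0r mulN1r; lra.
  rewrite -natr1 addrK ltW// -grid_class_gt ?E//.
  by rewrite -ltnS -E.
by rewrite ler_norml; nra.
Qed.

Lemma measurable_grid_class_gt (k : 'I_K) :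
  measurable ([set u | (k < grid_class u)%N] : set (measurableTypeR R)).
Proof.
rewrite (_ : [set u | _] = `]k%:R * mesh, +oo[%classic); first exact: measurable_itv.
by apply/seteqP; split => u /=; rewrite in_itv/= andbT grid_class_gt.
Qed.

(** Summation by parts: it makes a mean of rounded values linear in the tail frequencies, with the
    same coefficients for the true and for the empirical law. *)
Lemma grid_telescope (f : R -> R) (i : 'I_K.+1) :
  f (i%:R * mesh) = f 0 +
    \sum_(k < K) (f (k.+1%:R * mesh) - f (k%:R * mesh)) * (k < i)%N%:R.
Proof.
rewrite (eq_bigr (fun k : 'I_K =>
    if (k < i)%N then f (k.+1%:R * mesh) - f (k%:R * mesh) else 0)).
  have iK : (i <= K)%N by rewrite -ltnS.
  rewrite -big_mkcond/= -(big_ord_widen _ (fun k => f (k.+1%:R * mesh) - f (k%:R * mesh)) iK).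
  rewrite -(big_mkord predT (fun k => f (k.+1%:R * mesh) - f (k%:R * mesh))).
  by rewrite (telescope_sumr (fun k => f (k%:R * mesh)))// mul0r subrKC.
by move=> k _; case: ifP; rewrite ?mulr1 ?mulr0.
Qed.

End grid.

(** A class is determined by which levels [k < K] it exceeds. *)
Lemma measurable_class (R : realType) (K : nat) (c : R -> 'I_K.+1) :
  (forall k : 'I_K, measurable ([set u | (k < c u)%N] : set (measurableTypeR R))) ->
  forall i, measurable (c @^-1` [set i] : set (measurableTypeR R)).
Proof.
move=> mc i.
rewrite (_ : c @^-1` _ = \bigcap_(k in [set: 'I_K]) [set u | (k < c u)%N = (k < i)%N]).
  apply: fin_bigcap_measurable => // k _; case: (k < i)%N.
    exact: mc.
  rewrite (_ : [set u | _] = ~` [set u | (k < c u)%N]); first by apply: measurableC; exact: mc.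
  by apply/seteqP; split => u /=; [move=> ->|move/negP/negbTE].
apply/seteqP; split => [u /= <-//|u /= H].
apply/val_inj/eqP; rewrite /= eqn_leq; apply/andP; split; rewrite leqNgt; apply/negP => lt.
  have iK : (i < K)%N by rewrite (leq_trans lt)// -ltnS.
  by have := H (Ordinal iK) I; rewrite /= lt ltnn.
have iK : (c u < K)%N by rewrite (leq_trans lt)// -ltnS.
by have := H (Ordinal iK) I; rewrite /= lt ltnn.
Qed.

(** * Two-sided deviation of the grid frequencies *)

Lemma rev_ord_gt (K : nat) (k : 'I_K) (i : 'I_K.+1) :
  (k < rev_ord i)%N = ~~ (rev_ord k < i)%N.
Proof. by rewrite /= -leqNgt; have := ltn_ord k; have := ltn_ord i; lia. Qed.

Section two_sided.
Variables (R : realType) (K M : nat) (Dbar : R).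
Variables (d : measure_display) (Omega : measurableType d).
Variables (Pr : probability Omega R) (X : nat -> {RV Pr >-> R}).
Variable P : probability (measurableTypeR R) R.
Hypotheses (Dbar_gt0 : 0 < Dbar) (K_gt0 : (0 < K)%N) (M_gt0 : (0 < M)%N).
Hypothesis iidX : iid M X P.

Let c := @grid_class R K Dbar.
Let c' (u : R) := rev_ord (c u).

Definition grid_mass : nat -> R := upper_tail (class_mass P c).

Definition grid_count (k : nat) (w : Omega) : nat := \sum_(j < M) (k < c (X j w))%N.

Let mc : forall i, measurable (c @^-1` [set i] : set (measurableTypeR R)).
Proof. by apply: measurable_class => k; exact: measurable_grid_class_gt. Qed.

Let mc' : forall i, measurable (c' @^-1` [set i] : set (measurableTypeR R)).
Proof.
move=> i; rewrite (_ : _ @^-1` _ = c @^-1` [set rev_ord i]); first exact: mc.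
by apply/seteqP; split => u /=; [move=> <-|rewrite /c' => ->]; rewrite rev_ordK.
Qed.

Lemma grid_massE (k : nat) : (grid_mass k)%:E = P [set u | (k < c u)%N].
Proof. exact: upper_tail_class. Qed.

Let rev_mass (k : 'I_K) : upper_tail (class_mass P c') k = 1 - grid_mass (rev_ord k).
Proof.
apply: EFin_inj; rewrite EFinB grid_massE upper_tail_class; last exact: mc'.
rewrite -probability_setC; last exact: measurable_grid_class_gt.
congr (P _); apply/seteqP; split => u /=; rewrite rev_ord_gt.
  by move/negP.
by move=> H; apply/negP.
Qed.

Let rev_count (k : 'I_K) (w : Omega) :
  (exceedances k (sample_config M X c' w))%:R = M%:R - (grid_count (rev_ord k) w)%:R :> R.
Proof.
apply/eqP; rewrite eq_sym subr_eq -natrD eqr_nat; apply/eqP.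
rewrite /exceedances /grid_count -big_split/= (eq_bigr (fun=> 1%N)).
  by rewrite sum_nat_const card_ord muln1.
by move=> j _; rewrite ffunE rev_ord_gt; case: (_ < _)%N.
Qed.

(** Upper deviations are those of the classes [c]; lower deviations are upper deviations of the
    reversed classes [c'], whose tail masses and counts are complementary. The union bound gives the
    factor [2]. *)
Lemma two_sided_dkw (e : R) : 0 < e < 1 ->
  exists B : set Omega, [/\ measurable B,
    (Pr B <= (2 * expR (- (2 * M%:R * e ^+ 2)))%:E)%E &
    forall w, ~ B w -> forall k : 'I_K,
      `|M%:R^-1 * (grid_count k w)%:R - grid_mass k| <= e].
Proof.
move=> e01.
have Mr0 : 0 < M%:R :> R by rewrite ltr0n.
pose p1 := fun f : {ffun 'I_M -> 'I_K.+1} =>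
  [exists k : 'I_K, M%:R * (upper_tail (class_mass P c) k + e) <= (exceedances k f)%:R].
pose p2 := fun f : {ffun 'I_M -> 'I_K.+1} =>
  [exists k : 'I_K, M%:R * (upper_tail (class_mass P c') k + e) <= (exceedances k f)%:R].
pose B1 := [set w | p1 (sample_config M X c w)].
pose B2 := [set w | p2 (sample_config M X c' w)].
have mB1 : measurable B1 by exact: measurable_sample_config.
have mB2 : measurable B2 by exact: measurable_sample_config.
exists (B1 `|` B2); split.
- exact: measurableU.
- apply: le_trans (measureU2 _ mB1 mB2) _.
  rewrite (_ : 2 * expR _ = expR (- (2 * M%:R * e ^+ 2)) + expR (- (2 * M%:R * e ^+ 2))).
    by rewrite EFinD leeD// empirical_exceedance.
  by ring.
- move=> w /not_orP[/negP nB1 /negP nB2] k.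
  move: nB1; rewrite negb_exists => /forallP/(_ k); rewrite -ltNge => H1.
  move: nB2; rewrite negb_exists => /forallP/(_ (rev_ord k)); rewrite -ltNge.
  rewrite rev_count rev_mass rev_ordK => H2.
  have {}H1 : (grid_count k w)%:R < M%:R * (grid_mass k + e).
    apply: le_lt_trans H1; rewrite ler_nat leq_eqVlt; apply/orP; left; apply/eqP.
    by apply: eq_bigr => j _; rewrite ffunE.
  have E : (grid_count k w)%:R = M%:R * (M%:R^-1 * (grid_count k w)%:R) :> R.
    by rewrite mulVKf ?gt_eqF.
  move: H1 H2; rewrite E mulKf ?gt_eqF//; set x : R := _^-1 * _; rewrite ltr_pM2l// => H1 H2.
  rewrite ler_norml; apply/andP; split; last lra.
  suff : grid_mass k - e < x by lra.
  by rewrite -(ltr_pM2l Mr0); lra.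
Qed.

End two_sided.

(** * Means under a demand law carried by an interval *)

Lemma measurable_period_cost (R : realType) (h p : R) (d : measure_display)
    (T : measurableType d) (f g : T -> R) :
  measurable_fun setT f -> measurable_fun setT g ->
  measurable_fun setT (fun w => period_cost h p (f w) (g w)).
Proof.
move=> mf mg; rewrite /period_cost /pos_part.
by apply: measurable_funD; apply: measurable_funM => //; apply: measurable_maxr => //;
  apply: measurable_funB.
Qed.

Section mean_on_interval.
Variables (R : realType) (Dbar : R) (P : probability (measurableTypeR R) R).
Hypothesis PD : P `[0, Dbar]%classic = 1%E.

Let A : set (measurableTypeR R) := `[0, Dbar]%classic.
Let mA : measurable A. Proof. exact: measurable_itv. Qed.

Let PA : P A = 1%E. Proof. exact: PD. Qed.

Lemma outside_null : P (~` A) = 0%E.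
Proof. by rewrite probability_setC// PD subee. Qed.

Lemma measure_on_interval (S : set (measurableTypeR R)) : measurable S ->
  P (S `&` A) = P S.
Proof.
move=> mS; rewrite -[in RHS](setIT S) -(setUv A) setIUr measureU0//.
- exact: measurableI.
- exact/measurableI/measurableC.
apply: subset_measure0 outside_null; last exact: subIsetr.
  exact/measurableI/measurableC.
exact: measurableC.
Qed.

Lemma ge0_integral_on_interval (f : R -> R) : measurable_fun setT f ->
  (forall u, 0 <= f u) -> (\int[P]_u (f u)%:E = \int[P]_(u in A) (f u)%:E)%E.
Proof.
move=> mf f0; rewrite (ge0_negligible_integral (measurableC mA) measurableT _ _ outside_null).
- by rewrite setTD setCK.
- exact/measurable_EFinP.
- by move=> u _; rewrite lee_fin.
Qed.

Lemma integrable_on_interval (f : measurableTypeR R -> R) (B : R) : measurable_fun setT f ->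
  (forall u, A u -> `|f u| <= B) -> P.-integrable A (EFin \o f).
Proof.
move=> mf fB; apply: measurable_bounded_integrable => //.
- by rewrite (le_lt_trans (probability_le1 P mA))// ltry.
- exact: measurable_funTS.
- exists B; split; first exact: num_real.
  by move=> x Bx u Au; exact: le_trans (fB u Au) (ltW Bx).
Qed.

Lemma mean_lincomb_indic (n : nat) (b : R) (a : 'I_n -> R)
    (S : 'I_n -> set (measurableTypeR R)) : (forall k, measurable (S k)) ->
  \int[P]_(u in A) (b + \sum_(k < n) a k * \1_(S k) u) =
  b + \sum_(k < n) a k * fine (P (S k)).
Proof.
move=> mS.
have iS k : P.-integrable A (EFin \o (fun u => a k * \1_(S k) u)).
  apply: (@integrable_on_interval _ `|a k|).
    by apply: measurable_funM; [exact: measurable_cst|exact: measurable_indic (mS k)].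
  move=> u _; rewrite normrM ler_piMr// indicE; case: (_ \in _); rewrite ?normr1 ?normr0//.
have E : (fun u => \sum_(k < n) (a k * \1_(S k) u)%:E) =
    EFin \o (fun u => \sum_(k < n) a k * \1_(S k) u).
  by apply/funext => u; rewrite sumEFin.
have isum : P.-integrable A (EFin \o (fun u => \sum_(k < n) a k * \1_(S k) u)).
  by rewrite -E; apply: integrable_sum => // k _; exact: iS.
rewrite RintegralD//; last exact: finite_measure_integrable_cst.
rewrite Rintegral_cst// [X in b * X](_ : _ = 1) ?mulr1; last exact: (congr1 fine PA).
congr (_ + _).
rewrite /Rintegral -[X in integral _ _ X]/(EFin \o _) -E integral_sum//.
rewrite (eq_bigr (fun k => (a k * fine (P (S k)))%:E)) ?sumEFin// => k _.
rewrite -[LHS]/(\int[P]_(u in A) ((a k)%:E * (\1_(S k) u)%:E))%E integralZl//.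
  rewrite integral_indic// EFinM fineK ?fin_num_measure//; congr (_ * _)%E.
  exact: measure_on_interval.
apply: (@integrable_on_interval _ 1); first exact: measurable_indic (mS k).
by move=> u _; rewrite indicE; case: (_ \in _); rewrite ?normr1 ?normr0.
Qed.

(** On [[0, Dbar]] the cost is bounded, hence integrable, so that means can be subtracted and
    compared. *)
Lemma expected_period_cost_interval (h p s : R) : 0 < h -> 0 < p ->
  expected_period_cost h p P s = \int[P]_(u in A) period_cost h p s u.
Proof.
move=> h0 p0; rewrite /expected_period_cost unlock ge0_integral_on_interval//.
  by apply: measurable_period_cost; [exact: measurable_cst|exact: measurable_id].
by move=> u; exact: period_cost_ge0.
Qed.

Hypothesis Dbar_gt0 : 0 < Dbar.

Lemma integrable_lipschitz (f : measurableTypeR R -> R) (L : R) :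
  measurable_fun setT f -> 0 <= L ->
  (forall u v, `|f u - f v| <= L * `|u - v|) -> P.-integrable A (EFin \o f).
Proof.
move=> mf L0 fL; apply: (@integrable_on_interval _ (`|f 0| + L * Dbar)) => // u.
rewrite /A/= in_itv/= => /andP[u0 uD].
rewrite -[f u](subrK (f 0)) addrC (le_trans (ler_normD _ _))// lerD2l.
by rewrite (le_trans (fL _ _))// subr0 ger0_norm// ler_wpM2l.
Qed.

(** Rounding the demand to the grid moves [f] by at most [L] times the mesh, and [grid_telescope]
    computes the mean of the rounded function. *)
Lemma mean_grid (f : measurableTypeR R -> R) (L : R) (K : nat) : (0 < K)%N ->
  measurable_fun setT f -> 0 <= L -> (forall u v, `|f u - f v| <= L * `|u - v|) ->
  `|\int[P]_(u in A) f u - (f 0 + \sum_(k < K)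
     (f (k.+1%:R * mesh K Dbar) - f (k%:R * mesh K Dbar)) * grid_mass K Dbar P k)|
  <= L * mesh K Dbar.
Proof.
move=> K0 mf L0 fL; set a := fun k : 'I_K => f (k.+1%:R * mesh K Dbar) - f (k%:R * mesh K Dbar).
pose S (k : 'I_K) : set (measurableTypeR R) := [set u | (k < grid_class K Dbar u)%N].
have mS k : measurable (S k) by exact: measurable_grid_class_gt.
have -> : \sum_(k < K) a k * grid_mass K Dbar P k = \sum_(k < K) a k * fine (P (S k)).
  by apply: eq_bigr => k _; congr (_ * _); rewrite -grid_massE.
rewrite -mean_lincomb_indic//.
have stepE u : f 0 + \sum_(k < K) a k * \1_(S k) u = f ((grid_class K Dbar u)%:R * mesh K Dbar).
  rewrite grid_telescope//; congr (_ + _); apply: eq_bigr => k _; congr (_ * _).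
  by rewrite indicE /S mem_setE.
have if_ := integrable_lipschitz mf L0 fL.
have is_ : P.-integrable A (EFin \o (fun u => f 0 + \sum_(k < K) a k * \1_(S k) u)).
  apply: (@integrable_on_interval _ (`|f 0| + \sum_(k < K) `|a k|)).
    apply: measurable_funD; first exact: measurable_cst.
    by apply: measurable_sum => k; apply: measurable_funM;
      [exact: measurable_cst|exact: measurable_indic (mS k)].
  move=> u _; rewrite (le_trans (ler_normD _ _))// lerD2l (le_trans (ler_norm_sum _ _ _))//.
  apply: ler_sum => k _; rewrite normrM ler_piMr// indicE.
  by case: (_ \in _); rewrite ?normr1 ?normr0.
have iB : P.-integrable A
    (EFin \o (fun u => f u - (f 0 + \sum_(k < K) a k * \1_(S k) u))).
  exact: (integrableB mA if_ is_).
rewrite -RintegralB//; apply: le_trans (le_normr_Rintegral mA iB) _.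
apply: (@le_trans _ _ (\int[P]_(u in A) (L * mesh K Dbar))); last first.
  by rewrite Rintegral_cst// [X in _ * X](_ : _ = 1) ?mulr1//; exact: (congr1 fine PA).
apply: le_Rintegral => //.
- exact: integrable_norm iB.
- exact: finite_measure_integrable_cst.
move=> u Au; rewrite stepE (le_trans (fL _ _))// ler_wpM2l//.
by apply: grid_class_approx => //; move: Au; rewrite /A/= in_itv.
Qed.

End mean_on_interval.

(** * Deviation of the cost function, uniformly in the level *)

Section uniform_deviation.
Variables (R : realType) (K M : nat) (h p Dbar : R).
Variables (d : measure_display) (Omega : measurableType d).
Variables (Pr : probability Omega R) (X : nat -> {RV Pr >-> R}).
Variable P : probability (measurableTypeR R) R.
Hypotheses (h_gt0 : 0 < h) (p_gt0 : 0 < p).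
Hypotheses (Dbar_gt0 : 0 < Dbar) (K_gt0 : (0 < K)%N) (M_gt0 : (0 < M)%N).
Hypothesis PD : P `[0, Dbar]%classic = 1%E.

(** The counterpart of [mean_grid] for the empirical law: same coefficients, with observed
    frequencies in place of [grid_mass]. *)
Lemma empirical_grid (w : Omega) (s : R) :
  (forall j : 'I_M, 0 <= X j w <= Dbar) ->
  `|empirical_period_cost h p M (fun j => X j w) s - (period_cost h p s 0 + \sum_(k < K)
     (period_cost h p s (k.+1%:R * mesh K Dbar) - period_cost h p s (k%:R * mesh K Dbar)) *
     (M%:R^-1 * (grid_count K M Dbar X k w)%:R))|
  <= Num.max h p * mesh K Dbar.
Proof.
move=> XD; set f := period_cost h p s.
have M0 : M%:R != 0 :> R by rewrite pnatr_eq0 -lt0n.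
pose c := grid_class K Dbar.
have -> : f 0 + \sum_(k < K) (f (k.+1%:R * mesh K Dbar) - f (k%:R * mesh K Dbar)) *
     (M%:R^-1 * (grid_count K M Dbar X k w)%:R) =
   M%:R^-1 * \sum_(j < M) f ((c (X j w))%:R * mesh K Dbar).
  under [in RHS]eq_bigr => j _ do rewrite grid_telescope//.
  rewrite big_split/= sumr_const card_ord -[f 0 *+ M]mulr_natl mulrDr mulKf//; congr (_ + _).
  rewrite exchange_big/= mulr_sumr; apply: eq_bigr => k _.
  by rewrite -mulr_sumr mulrCA; congr (_ * (_ * _)); rewrite natr_sum.
rewrite /empirical_period_cost -mulrBr -sumrB normrM ger0_norm ?invr_ge0//.
rewrite ler_pdivrMl ?ltr0n// (le_trans (ler_norm_sum _ _ _))//.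
rewrite mulr_natl -[X in _ *+ X]card_ord -sumr_const; apply: ler_sum => j _.
rewrite (le_trans (period_cost_lipschitz _ _ _ h_gt0 p_gt0))// ler_wpM2l//.
  by rewrite le_max (ltW h_gt0).
exact: grid_class_approx.
Qed.

(** Each of the [K] coefficients is at most [Num.max h p] times the mesh in absolute value, so they
    total at most [Num.max h p * Dbar]; the last term collects the two rounding errors. The
    assumptions on [w] do not involve [s], so one event controls all levels. *)
Lemma uniform_deviation (e : R) (w : Omega) (s : R) :
  (forall j : 'I_M, 0 <= X j w <= Dbar) ->
  (forall k : 'I_K, `|M%:R^-1 * (grid_count K M Dbar X k w)%:R - grid_mass K Dbar P k| <= e) ->
  `|empirical_period_cost h p M (fun j => X j w) s - expected_period_cost h p P s|
  <= Num.max h p * Dbar * e + 2 * (Num.max h p * mesh K Dbar).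
Proof.
move=> XD He; have L0 : 0 <= Num.max h p by rewrite le_max (ltW h_gt0).
have := empirical_grid s XD.
have fL u v := @period_cost_lipschitz R h p s u v h_gt0 p_gt0.
have mf : measurable_fun setT (period_cost h p s : measurableTypeR R -> R).
  by apply: measurable_period_cost; [exact: measurable_cst|exact: measurable_id].
have := mean_grid PD Dbar_gt0 K_gt0 mf L0 fL; rewrite -expected_period_cost_interval//.
set f := period_cost h p s; set x := empirical_period_cost _ _ _ _ _.
set y := expected_period_cost _ _ _ _; set a := \sum_(k < K) _; set b := \sum_(k < K) _.
move=> H1 H2.
have H3 : `|b - a| <= Num.max h p * Dbar * e.
  rewrite -sumrB (le_trans (ler_norm_sum _ _ _))//.
  apply: (@le_trans _ _ (\sum_(k < K) Num.max h p * mesh K Dbar * e)).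
    apply: ler_sum => k _; rewrite -mulrBr normrM ler_pM//.
    rewrite (le_trans (fL _ _))// ler_wpM2l// -mulrBl -natr1 addrAC subrr add0r mul1r.
    by rewrite ger0_norm// ltW// mesh_gt0.
  rewrite sumr_const card_ord -mulr_natl /mesh.
  rewrite le_eqVlt; apply/orP; left; apply/eqP; field.
  by rewrite pnatr_eq0 -lt0n.
have -> : x - y = (x - (f 0 + b)) - (y - (f 0 + a)) + (b - a) by ring.
rewrite (le_trans (ler_normD _ _))// (le_trans (lerD (ler_normB _ _) (lexx _)))//; lra.
Qed.

End uniform_deviation.

(** * Concentration of the empirical minimum *)

Section minima.
Variables (R : realType) (Dbar : R).
Implicit Types f g : R -> R.

Lemma minimumE f s : s \in `[0, Dbar] ->
  (forall s', s' \in `[0, Dbar] -> f s <= f s') -> minimum Dbar f = f s.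
Proof.
move=> sD fs; have lb : lbound [set f s | s in `[0, Dbar]] (f s).
  by move=> _ [s' s'D <-]; exact: fs.
apply/eqP; rewrite eq_le; apply/andP; split.
  by apply: ge_inf; [exists (f s)|exists s].
by apply: lb_le_inf => //; exists (f s), s.
Qed.

Lemma minimum_le f s : minimum_attained Dbar f -> s \in `[0, Dbar] -> minimum Dbar f <= f s.
Proof. by move=> [m mD mP] sD; rewrite (minimumE mD mP); exact: mP. Qed.

Lemma minimum_dist f g (e : R) : minimum_attained Dbar f -> minimum_attained Dbar g ->
  (forall s, `|f s - g s| <= e) -> `|minimum Dbar f - minimum Dbar g| <= e.
Proof.
move=> [s sD sP] [s' sD' sP'] fg; rewrite (minimumE sD sP) (minimumE sD' sP').
move: (fg s) (fg s') (sP _ sD') (sP' _ sD); rewrite !ler_norml => /andP[] ? ? /andP[] ? ? ? ?.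
by apply/andP; split; lra.
Qed.

Hypothesis Dbar_gt0 : 0 < Dbar.

Lemma lipschitz_minimum_attained f (L : R) :
  (forall s s', `|f s - f s'| <= L * `|s - s'|) -> minimum_attained Dbar f.
Proof.
move=> fL; have L0 : 0 <= L.
  by have := le_trans (normr_ge0 _) (fL 1 0); rewrite subr0 normr1 mulr1.
suff cf : continuous f.
  have [|s sD sP] := @EVT_min R f 0 Dbar (ltW Dbar_gt0); last by exists s.
  exact: continuous_subspaceT.
move=> s; apply/cvgrPdist_le => /= e e0; near=> s'.
rewrite (le_trans (fL _ _))//.
(* Dividing by [L + 1] rather than [L] covers [L = 0]. *)
apply: (@le_trans _ _ (L * (e / (L + 1)))).
  rewrite ler_wpM2l// ltW//; near: s'; exists (e / (L + 1)) => //=.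
  by rewrite divr_gt0//; lra.
by rewrite mulrCA ler_piMr ?(ltW e0)// ler_pdivrMr; lra.
Unshelve. all: by end_near. Qed.

End minima.

Lemma period_cost_lipschitz_level (R : realType) (h p u s s' : R) : 0 < h -> 0 < p ->
  `|period_cost h p s u - period_cost h p s' u| <= Num.max h p * `|s - s'|.
Proof.
by move=> h0 p0; rewrite ![period_cost h p _ _]period_costC maxC; exact: period_cost_lipschitz.
Qed.

Lemma empirical_lipschitz (R : realType) (h p : R) (M : nat) (x : nat -> R) (s s' : R) :
  (0 < M)%N -> 0 < h -> 0 < p ->
  `|empirical_period_cost h p M x s - empirical_period_cost h p M x s'|
  <= Num.max h p * `|s - s'|.
Proof.
move=> M0 h0 p0; rewrite /empirical_period_cost -mulrBr -sumrB normrM ger0_norm ?invr_ge0//.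
rewrite ler_pdivrMl ?ltr0n// (le_trans (ler_norm_sum _ _ _))//.
rewrite mulr_natl -[X in _ *+ X]card_ord -sumr_const; apply: ler_sum => j _.
exact: period_cost_lipschitz_level.
Qed.

Lemma expected_lipschitz (R : realType) (h p Dbar : R) (P : probability (measurableTypeR R) R)
    (s s' : R) : 0 < h -> 0 < p -> 0 < Dbar -> P `[0, Dbar]%classic = 1%E ->
  `|expected_period_cost h p P s - expected_period_cost h p P s'|
  <= Num.max h p * `|s - s'|.
Proof.
move=> h0 p0 D0 PD; rewrite !(expected_period_cost_interval PD)//.
have L0 : 0 <= Num.max h p by rewrite le_max (ltW h0).
have mA : measurable (`[0, Dbar]%classic : set (measurableTypeR R)) by exact: measurable_itv.
have i_ (y : R) : P.-integrable `[0, Dbar]%classic (EFin \o period_cost h p y).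
  have mf : measurable_fun setT (period_cost h p y : measurableTypeR R -> R).
    by apply: measurable_period_cost; [exact: measurable_cst|exact: measurable_id].
  have fL u v := @period_cost_lipschitz R h p y u v h0 p0.
  exact: (integrable_lipschitz Dbar P mf L0 fL).
have iB := integrableB mA (i_ s) (i_ s').
rewrite -RintegralB//; apply: le_trans (le_normr_Rintegral mA iB) _.
apply: (@le_trans _ _
  (\int[P]_(u in `[0, Dbar]%classic) (Num.max h p * `|s - s'|))); last first.
  by rewrite Rintegral_cst// [X in _ * X](_ : _ = 1) ?mulr1//; exact: (congr1 fine PD).
apply: le_Rintegral => //.
- exact: integrable_norm iB.
- exact: finite_measure_integrable_cst.
by move=> u _; exact: period_cost_lipschitz_level.
Qed.

Section concentration.
Variables (R : realType) (M : nat) (h p Dbar : R).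
Variables (d : measure_display) (Omega : measurableType d).
Variables (Pr : probability Omega R) (X : nat -> {RV Pr >-> R}).
Variable P : probability (measurableTypeR R) R.
Hypotheses (h_gt0 : 0 < h) (p_gt0 : 0 < p) (Dbar_gt0 : 0 < Dbar) (M_gt0 : (0 < M)%N).
Hypothesis PD : P `[0, Dbar]%classic = 1%E.
Hypothesis iidX : iid M X P.

Let ghat (w : Omega) := empirical_period_cost h p M (fun j => X j w).
Let L := Num.max h p.
Let L_gt0 : 0 < L. Proof. by rewrite lt_max h_gt0. Qed.

Lemma empirical_minimum_attained w : minimum_attained Dbar (ghat w).
Proof.
by apply: (@lipschitz_minimum_attained _ _ Dbar_gt0 _ L) => s s'; exact: empirical_lipschitz.
Qed.

Lemma expected_minimum_attained : minimum_attained Dbar (expected_period_cost h p P).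
Proof.
apply: (@lipschitz_minimum_attained _ _ Dbar_gt0 _ L) => s s'.
exact: expected_lipschitz PD.
Qed.

Lemma measurable_empirical_period_cost (s : R) : measurable_fun setT (fun w => ghat w s).
Proof.
apply: measurable_funM; first exact: measurable_cst.
apply: measurable_sum => j; apply: measurable_period_cost; first exact: measurable_cst.
exact: measurable_funP.
Qed.

(** By the Lipschitz bound, the minimum is at least [a] as soon as [ghat] is at least [a] at
    countably many dense points, which makes the event a countable intersection. *)
Lemma measurable_empirical_minimum : measurable_fun setT (fun w => minimum Dbar (ghat w)).
Proof.
apply: (measurability _ (RGenCInfty.measurableE R)) => //= _ [_ [a ->] <-].
pose pt (n k : nat) : R := Num.min Dbar (k%:R / n.+1%:R).
have ptD n k : pt n k \in `[0, Dbar].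
  by rewrite in_itv/= ge_min lexx/= le_min (ltW Dbar_gt0)/= divr_ge0.
rewrite (_ : _ `&` _ = \bigcap_n \bigcap_k [set w | a <= ghat w (pt n k)]).
  apply: bigcapT_measurable => n; apply: bigcapT_measurable => k.
  rewrite -[X in measurable X]setTI -preimage_itvcy.
  exact: (measurable_empirical_period_cost (pt n k) measurableT (measurable_itv _)).
rewrite setTI preimage_itvcy; apply/seteqP; split => w /=.
  move=> aw n _ k _ /=; apply: (le_trans aw).
  exact: minimum_le (empirical_minimum_attained w) (ptD n k).
move=> aw; rewrite leNgt; apply/negP.
have [s sD sP] := empirical_minimum_attained w; rewrite (minimumE sD sP) => sa.
move: sD; rewrite in_itv/= => /andP[s0 sD].
(* The mesh [1 / n.+1] is too fine for [ghat] to climb from its minimum to [a] within one step;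
   rounding [s] down keeps the point below [Dbar]. *)
pose n := Num.truncn (L / (a - ghat w s)).
pose k := Num.truncn (s * n.+1%:R).
have as0 : 0 < a - ghat w s by rewrite subr_gt0.
have nP : L / n.+1%:R < a - ghat w s.
  rewrite ltr_pdivrMr// mulrC -ltr_pdivrMr//; exact: truncnS_gt.
have sn0 : 0 <= s * n.+1%:R by rewrite mulr_ge0.
have /andP[k1 k2] := truncn_itv sn0.
have pE : pt n k = k%:R / n.+1%:R.
  by apply/min_idPr; apply: le_trans sD; rewrite ler_pdivrMr.
have := aw n I k I; rewrite /= pE leNgt => /negP; apply.
have dist : `|k%:R / n.+1%:R - s| <= n.+1%:R^-1.
  have -> : k%:R / n.+1%:R - s = (k%:R - s * n.+1%:R) / n.+1%:R.
    by rewrite mulrBl mulfK.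
  rewrite normrM [`|_^-1|]ger0_norm ?invr_ge0// ler_piMl ?invr_ge0//.
  by rewrite ler_norml lerBlDr lerBrDr; move: k1 (ltW k2); rewrite -/k -natr1; lra.
have := @empirical_lipschitz R h p M (fun j => X j w) (k%:R / n.+1%:R) s M_gt0 h_gt0 p_gt0.
rewrite -/(ghat w) -/L ler_norml => /andP[_ H].
have : L * `|k%:R / n.+1%:R - s| <= L / n.+1%:R by rewrite ler_pM2l.
by move: nP H; set x := L / _; set y := ghat w (_ / _); set z := L * _ => ? ? ?; lra.
Qed.

Lemma measurable_empirical_deviation (c v e : R) :
  measurable [set w | `|c * minimum Dbar (ghat w) - v| <= e].
Proof.
rewrite -[X in measurable X]setTI -preimage_itvNyc.
have mf : measurable_fun setT (fun w => `|c * minimum Dbar (ghat w) - v|).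
  apply: measurableT_comp => //; apply: measurable_funB; last exact: measurable_cst.
  by apply: measurable_funM; [exact: measurable_cst|exact: measurable_empirical_minimum].
exact: (mf measurableT _ (measurable_itv _)).
Qed.

(** The law confines the observations to [[0, Dbar]] only almost surely, so this null event is added
    to the exceptional sets. *)
Definition outside_interval := [set w | [exists j : 'I_M, ~~ (0 <= X j w <= Dbar)]].

Lemma outside_interval_null : measurable outside_interval /\ Pr outside_interval = 0%E.
Proof.
have mD : measurable (~` `[0, Dbar]%classic : set (measurableTypeR R)).
  by apply: measurableC; exact: measurable_itv.
have mX (j : nat) : measurable (X j @^-1` ~` `[0, Dbar]%classic).
  exact: (measurable_funPTI (X j) mD).
have E : outside_interval = \bigcup_(j in [set: 'I_M]) (X j @^-1` ~` `[0, Dbar]%classic).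
  apply/seteqP; split => w /=.
    by move=> /existsP[j jw]; exists j => //=; rewrite in_itv/=; exact/negP.
  by move=> [j _ /=]; rewrite in_itv/= => /negP jw; apply/existsP; exists j.
have mo : measurable outside_interval by rewrite E; apply: fin_bigcup_measurable.
split=> //; apply/eqP; rewrite -measure_le0.
apply: le_trans (@measure_finite_cover _ _ _ Pr 'I_M predT
  (fun j => X j @^-1` ~` `[0, Dbar]%classic) outside_interval mo _ _) _ => //.
  by move=> w; rewrite E => -[j _ jw]; exists j.
rewrite big1// => j _; have [_ law] := iidX.
rewrite -[LHS]/(distribution Pr (X j) _) law//.
exact: outside_null.
Qed.

(* for e >= 1 the exceptional set is empty: both frequencies lie in [0, 1] *)
Lemma frequency_deviation (K : nat) (e : R) : (0 < K)%N -> 0 < e ->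
  exists B : set Omega, [/\ measurable B,
    (Pr B <= (2 * expR (- (2 * M%:R * e ^+ 2)))%:E)%E &
    forall w, ~ B w -> forall k : 'I_K,
      `|M%:R^-1 * (grid_count K M Dbar X k w)%:R - grid_mass K Dbar P k| <= e].
Proof.
move=> K0 e0; have [e1|e1] := ltP e 1.
  by apply: two_sided_dkw => //; rewrite e0.
exists set0; split => //.
  by rewrite measure0 lee_fin mulr_ge0// expR_ge0.
move=> w _ k; apply: le_trans e1.
have m01 : 0 <= grid_mass K Dbar P k <= 1.
  rewrite -!lee_fin grid_massE// measure_ge0/= probability_le1//.
  exact: measurable_grid_class_gt.
have c01 : 0 <= (M%:R^-1 * (grid_count K M Dbar X k w)%:R : R) <= 1.
  rewrite mulr_ge0 ?invr_ge0//= ler_pdivrMl ?ltr0n// mulr1 ler_nat.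
  rewrite -[leqRHS]card_ord -sum1_card; apply: leq_sum => j _; exact: leq_b1.
by rewrite ler_norml; lra.
Qed.

(** For [e' < e], a fine enough grid fits its rounding error into [L * Dbar * (e - e')], which gives
    the bound with [e']. The event itself does not depend on the grid, so [e'] may tend to [e]. *)
Lemma empirical_minimum_tail (e : R) : 0 < e ->
  (Pr [set w | (L * Dbar * e <
     `|minimum Dbar (ghat w) - minimum Dbar (expected_period_cost h p P)|)%R]
   <= (2 * expR (- (2 * M%:R * e ^+ 2)))%:E)%E.
Proof.
move=> e0; set v := minimum Dbar (expected_period_cost h p P).
set A := [set w | _].
have mA : measurable A.
  rewrite (_ : A = ~` [set w | `|1 * minimum Dbar (ghat w) - v| <= L * Dbar * e]).
    by apply: measurableC; exact: measurable_empirical_deviation.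
  by apply/seteqP; split => w; rewrite /A/= mul1r ltNge => /negP.
have tail e' : 0 < e' -> e' < e -> (Pr A <= (2 * expR (- (2 * M%:R * e' ^+ 2)))%:E)%E.
  move=> e'0 e'e; pose K := (Num.truncn (2 / (e - e'))).+1.
  have K0 : (0 < K)%N by [].
  have [B [mB PB BP]] := frequency_deviation K0 e'0.
  have [mo Po] := outside_interval_null.
  apply: (@le_trans _ _ (Pr (outside_interval `|` B))).
    apply: le_measure; rewrite ?inE//; first exact: measurableU.
    move=> w Aw; apply: contrapT => /not_orP[/negP]; rewrite negb_exists => /forallP ow nB.
    have XD (j : 'I_M) : 0 <= X j w <= Dbar by have := ow j; rewrite negbK.
    have := minimum_dist (empirical_minimum_attained w) expected_minimum_attained
      (fun s => uniform_deviation h_gt0 p_gt0 Dbar_gt0 K0 M_gt0 PD s XD (BP w nB)).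
    apply/negP; rewrite -ltNge; apply: le_lt_trans Aw.
    rewrite -/L /mesh.
    have KP : 2 < (e - e') * K%:R.
      by rewrite mulrC -ltr_pdivrMr ?subr_gt0//; exact: truncnS_gt.
    have KR : 0 < K%:R :> R by rewrite ltr0n.
    have -> : 2 * (L * (Dbar / K%:R)) = L * Dbar * (2 / K%:R) by field; rewrite gt_eqF.
    rewrite -mulrDr ler_pM2l ?mulr_gt0// -lerBrDl ler_pdivrMr// ltW//.
  by apply: le_trans (measureU2 _ mo mB) _; rewrite -[leRHS]add0e leeD//; rewrite -Po.
have PA : Pr A = (fine (Pr A))%:E by rewrite fineK// fin_num_measure.
rewrite PA lee_fin leNgt; apply/negP => lt.
(* A strict excess over the bound at [e] would persist over the bound at some [x] slightly below
   [e], contradicting [tail]. *)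
have cphi : 2 * expR (- (2 * M%:R * x ^+ 2)) @[x --> e^'-] --> 2 * expR (- (2 * M%:R * e ^+ 2)).
  apply: cvgM; first exact: cvg_cst.
  apply: (cvg_comp _ (@expR R)); last exact: continuous_expR.
  apply: cvgN; apply: cvgM; first exact: cvg_cst.
  apply: cvg_at_left_filter; exact: exprn_continuous.
have : \forall x \near e^'-, [/\ 0 < x, x < e & 2 * expR (- (2 * M%:R * x ^+ 2)) < fine (Pr A)].
  near=> x; split.
  - by near: x; exact: nbhs_left_gt.
  - by near: x; exact: nbhs_left_lt.
  - by near: x; exact: cvgr_lt cphi _ lt.
move=> /filter_ex[x [x0 xe]].
by apply/negP; rewrite -leNgt -lee_fin -PA; exact: tail.
Unshelve. all: by end_near. Qed.

(** Any [b] above the radius is allowed, so that the lemma serves both a given [eta] and a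
    prescribed accuracy. The root [e] solves [2 * M%:R * e ^+ 2 = ln (2 / eta)], which makes the
    failure probability at most [eta]. *)
Lemma empirical_cost_concentration (T : nat) (eta b : R) : 0 < eta < 1 ->
  T%:R * L * Dbar * Num.sqrt (ln (2 / eta) / (2 * M%:R)) <= b ->
  with_probability_at_least Pr (1 - eta)
    [set w | `|empirical_cost h p Dbar T M (fun j => X j w) -
               T%:R * minimum Dbar (expected_period_cost h p P)| <= b].
Proof.
move=> /andP[eta0 eta1] Tb; set v := minimum Dbar (expected_period_cost h p P).
set E := [set w | _].
have mE : measurable E by exact: measurable_empirical_deviation.
split=> //; set e := Num.sqrt _ in Tb.
have ln0 : 0 < ln (2 / eta) by rewrite ln_gt0// ltr_pdivlMr//; lra.
have M0 : 0 < 2 * M%:R :> R by rewrite mulr_gt0// ltr0n.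
have e0 : 0 < e by rewrite sqrtr_gt0 divr_gt0.
have eE : 2 * M%:R * e ^+ 2 = ln (2 / eta).
  by rewrite sqr_sqrtr ?divr_ge0 ?ltW// mulrC divfK ?gt_eqF.
have etaE : 2 * expR (- ln (2 / eta)) = eta.
  by rewrite expRN lnK ?posrE ?divr_gt0// invf_div mulrC divfK.
have := empirical_minimum_tail e0; rewrite eE etaE -/v => tail.
have {}tail : (Pr (~` E) <= eta%:E)%E.
  apply: le_trans tail; apply: le_measure; rewrite ?inE.
  - exact: measurableC.
  - rewrite (_ : [set w | _] =
      ~` [set w | `|1 * minimum Dbar (ghat w) - v| <= L * Dbar * e]).
      by apply: measurableC; exact: measurable_empirical_deviation.
    by apply/seteqP; split => w /=; rewrite mul1r ltNge => /negP.
  - move=> w /=; rewrite /E/= => /negP; rewrite -ltNge /empirical_cost -mulrBr normrM.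
    rewrite ger0_norm// => lt; have T0 : 0 < T%:R :> R.
      rewrite lt_def ler0n andbT; apply/eqP => T0.
      by move: lt Tb; rewrite T0 !mul0r; lra.
    by rewrite -(ltr_pM2l T0); apply: le_lt_trans lt; rewrite !mulrA.
rewrite -[E]setCK probability_setC; last exact: measurableC.
by rewrite EFinB leeB.
Qed.

End concentration.

(** * Trajectories and independence *)

Section trajectory_measurability.
Variables (R : realType) (m : dynamics) (i : information) (pi : policy R) (x : R).
Variables (d : measure_display) (W : measurableType d).
Variables (zz : W -> seed pi) (uu : nat -> W -> R).
Hypothesis mzz : measurable_fun setT zz.

Lemma trajectoryS (z : seed pi) (u : nat -> R) (t : nat) :
  trajectory m i x z u t.+1 =
  ([tuple of ((trajectory m i x z u t).2, order_up_to m i x z u t, signal i (u t))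
     :: (trajectory m i x z u t).1],
   next_state m (order_up_to m i x z u t) (u t)).
Proof. by rewrite /order_up_to /=; case: (trajectory m i x z u t). Qed.

Lemma order_up_toE (z : seed pi) (u : nat -> R) (t : nat) :
  order_up_to m i x z u t =
  level (z, (trajectory m i x z u t).1, (trajectory m i x z u t).2).
Proof. by rewrite /order_up_to; case: (trajectory m i x z u t). Qed.

Let traj t w := trajectory m i x (zz w) (uu ^~ w) t.

Lemma measurable_order_up_to_of_trajectory (t : nat) :
  measurable_fun setT (fun w => (traj t w).1) ->
  measurable_fun setT (fun w => (traj t w).2 : measurableTypeR R) ->
  measurable_fun setT (fun w => order_up_to m i x (zz w) (uu ^~ w) t).
Proof.
move=> m1 m2.
rewrite (_ : (fun w => _) = (@level R pi t) \o
  (fun w => (zz w, (traj t w).1, (traj t w).2 : measurableTypeR R))); last first.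
  by apply/funext => w; rewrite order_up_toE.
apply: measurableT_comp; first exact: level_measurable.
by apply: measurable_fun_pair => //; apply: measurable_fun_pair.
Qed.

(** Only the demands before [t] are assumed measurable, and [W] is arbitrary. This covers the
    product of demands and seed, and also a fixed seed with the sigma-algebra of past demands, where
    it expresses nonanticipation. *)
Lemma measurable_trajectory (t : nat) :
  (forall j, (j < t)%N -> measurable_fun setT (uu j)) ->
  measurable_fun setT (fun w => (traj t w).1) /\
  measurable_fun setT (fun w => (traj t w).2 : measurableTypeR R).
Proof.
elim: t => [|t IH] mu; first by split; exact: measurable_cst.
have [|m1 m2] := IH; first by move=> j jt; apply: mu; rewrite ltnW.
have my := measurable_order_up_to_of_trajectory m1 m2.
have mut : measurable_fun setT (uu t) by exact: mu.
split.
  rewrite (_ : (fun w => _) = (fun w => [the t.+1.-tuple _ of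
    ((traj t w).2 : measurableTypeR R,
     order_up_to m i x (zz w) (uu ^~ w) t : measurableTypeR R,
     signal i (uu t w) : measurableTypeR R) :: (traj t w).1])); last first.
    by apply/funext => w; rewrite /traj trajectoryS.
  apply: measurable_cons => //; apply: measurable_fun_pair => /=.
    exact: measurable_fun_pair.
  by case: i => //=; exact: measurable_cst.
rewrite (_ : (fun w => _) =
  (fun w => next_state m (order_up_to m i x (zz w) (uu ^~ w) t) (uu t w))); last first.
  by apply/funext => w; rewrite /traj trajectoryS.
have mb : measurable_fun setT (fun w => order_up_to m i x (zz w) (uu ^~ w) t - uu t w).
  exact: measurable_funB.
by case: m mb => //= mb; apply: measurable_maxr => //; exact: measurable_cst.
Qed.

Lemma measurable_order_up_to (t : nat) :
  (forall j, (j < t)%N -> measurable_fun setT (uu j)) ->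
  measurable_fun setT (fun w => order_up_to m i x (zz w) (uu ^~ w) t).
Proof.
by move=> /measurable_trajectory[m1 m2]; exact: measurable_order_up_to_of_trajectory.
Qed.

End trajectory_measurability.

Section past_and_present.
Variables (R : realType) (d : measure_display) (Omega : measurableType d).
Variables (Pr : probability Omega R) (n : nat) (X : nat -> {RV Pr >-> R}).
Hypothesis indX : mutually_independent n X.

(** A pi-system generating the sigma-algebra of the demands before [t]. *)
Definition past_box (t : nat) : set (set Omega) :=
  [set E | exists2 A : nat -> set R, (forall j, measurable (A j)) &
    E = [set w | forall j, (j < t)%N -> A j (X j w)]].

Let measurable_box t E : past_box t E -> measurable E.
Proof.
move=> [A mA ->].
rewrite (_ : [set w | _] = \bigcap_(j in [set j | (j < t)%N]) (X j @^-1` A j)).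
  by apply: bigcap_measurableType => j _; exact: (measurable_funPTI (X j) (mA j)).
by apply/seteqP; split => w H j jt; exact: H.
Qed.

Let box_setI t : setI_closed (past_box t).
Proof.
move=> _ _ [A mA ->] [B mB ->]; exists (fun j => A j `&` B j).
  by move=> j; exact: measurableI.
apply/seteqP; split => w /=; first by move=> [HA HB] j jt; split; [exact: HA|exact: HB].
by move=> H; split => j jt; have [] := H j jt.
Qed.

Let box_setT t : past_box t setT.
Proof. by exists (fun=> setT) => //; apply/seteqP. Qed.

Let box_independent (t : 'I_n) (E : set Omega) (C : set R) : past_box t E ->
  measurable C -> Pr (E `&` X t @^-1` C) = (Pr (X t @^-1` C) * Pr E)%E.
Proof.
move=> [A mA ->] mC.
(* With [C] placed at index [t], both events are instances of the product rule, over [j < t] and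
   over [j <= t], for the same sets. *)
pose A' (j : 'I_n) := if (j < t)%N then A j else C.
have mA' j : measurable (A' j) by rewrite /A'; case: ifP.
have past_lt : [set w | forall j, (j < t)%N -> A j (X j w)] =
    \bigcap_(j in [set j | j \in [set j : 'I_n | (j < t)%N]%SET]) (X j @^-1` A' j).
  apply/seteqP; split => w /= H j.
    by rewrite /= inE => jt; rewrite /A' jt; exact: H.
  move=> jt; have jn : (j < n)%N by exact: ltn_trans jt (ltn_ord t).
  by have := H (Ordinal jn); rewrite /= inE /A' /= jt; exact.
have past_le : [set w | forall j, (j < t)%N -> A j (X j w)] `&` X t @^-1` C =
    \bigcap_(j in [set j | j \in [set j : 'I_n | (j <= t)%N]%SET]) (X j @^-1` A' j).
  rewrite past_lt; apply/seteqP; split => w /=.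
    move=> [H HC] j; rewrite /= inE leq_eqVlt => /orP[/eqP/val_inj ->|jt].
      by rewrite /A' ltnn.
    by apply: H; rewrite /= inE.
  move=> H; split; first by move=> j /=; rewrite inE => jt; apply: H; rewrite /= inE ltnW.
  by have := H t; rewrite /= inE leqnn /A' ltnn; exact.
rewrite past_le past_lt !indX//.
rewrite (bigD1 t) ?inE//= {1}/A' ltnn; congr (_ * _)%E.
by apply: eq_bigl => j; rewrite !inE ltn_neqAle andbC.
Qed.

(** For fixed [C], the restriction of [Pr] to the event that [X t] lies in [C] and the multiple of
    [Pr] by the probability of that event agree on past boxes, hence on the sigma-algebra they
    generate. *)
Lemma past_present_independent (t : 'I_n) (Y : Omega -> R) (B C : set R) :
  (forall S : set R, measurable S -> <<s past_box t >> (Y @^-1` S)) ->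
  measurable B -> measurable C ->
  Pr (Y @^-1` B `&` X t @^-1` C) = (Pr (Y @^-1` B) * Pr (X t @^-1` C))%E.
Proof.
move=> mY mB mC; have mXC : measurable (X t @^-1` C) by exact: (measurable_funPTI (X t) mC).
pose r : {nonneg R} := NngNum (fine_ge0 (measure_ge0 Pr (X t @^-1` C))).
have rE : (r%:num)%:E = Pr (X t @^-1` C) by rewrite /= fineK// fin_num_measure.
have H := @g_sigma_algebra_measure_unique d R Omega (past_box t) (@measurable_box t)
  (fun=> setT) (fun=> box_setT t) _ (mrestr Pr mXC) (mscale r Pr) (@box_setI t).
have {}H : forall E, <<s past_box t >> E -> mrestr Pr mXC E = mscale r Pr E.
  apply: H.
  - by rewrite bigcup_const//; exists 0%N.
  - by move=> E GE; rewrite -[RHS]/((r%:num)%:E * Pr E)%E rE; exact: box_independent.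
  - move=> _; rewrite -[X in (X < _)%E]/(Pr (setT `&` X t @^-1` C)) setTI.
    by rewrite (le_lt_trans (probability_le1 _ _))// ltry.
by have := H _ (mY B mB); rewrite -[RHS]/((r%:num)%:E * Pr (Y @^-1` B))%E rE muleC => <-.
Qed.

End past_and_present.

(** * The value of the inventory problem *)

Section newsvendor.
Variables (R : realType) (h p Dbar : R) (P : probability (measurableTypeR R) R).
Hypotheses (h_gt0 : 0 < h) (p_gt0 : 0 < p) (Dbar_gt0 : 0 < Dbar).
Hypothesis PD : P `[0, Dbar]%classic = 1%E.

Let g := expected_period_cost h p P.
Let v := minimum Dbar g.

Let measurable_cost (y : R) : measurable_fun setT (period_cost h p y : measurableTypeR R -> R).
Proof. by apply: measurable_period_cost; [exact: measurable_cst|exact: measurable_id]. Qed.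

Let integrable_cost (y : R) : P.-integrable `[0, Dbar]%classic (EFin \o period_cost h p y).
Proof.
have L0 : 0 <= Num.max h p by rewrite le_max (ltW h_gt0).
have fL u u' := @period_cost_lipschitz R h p y u u' h_gt0 p_gt0.
exact: (integrable_lipschitz Dbar P (measurable_cost y) L0 fL).
Qed.

Lemma integral_period_cost (y : R) : (\int[P]_u (period_cost h p y u)%:E = (g y)%:E)%E.
Proof.
rewrite /g (expected_period_cost_interval PD)// (ge0_integral_on_interval PD)//.
- rewrite /Rintegral fineK//; apply: integrable_fin_num; first exact: measurable_itv.
  exact: integrable_cost.
- exact: measurable_cost.
- by move=> u; exact: period_cost_ge0.
Qed.

(* above Dbar the newsvendor cost increases, so levels in [0, Dbar] suffice *)
Lemma minimum_le_expected (y : R) : 0 <= y -> v <= g y.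
Proof.
move=> y0; have att := expected_minimum_attained h_gt0 p_gt0 Dbar_gt0 PD.
have [yD|Dy] := leP y Dbar; first by apply: minimum_le => //; rewrite in_itv/= y0.
apply: (@le_trans _ _ (g Dbar)).
  by apply: minimum_le => //; rewrite in_itv/= lexx ltW.
rewrite /g !(expected_period_cost_interval PD)//.
apply: le_Rintegral => // u; rewrite /= in_itv/= => /andP[u0 uD].
rewrite /period_cost lerD// ler_wpM2l ?(ltW h_gt0) ?(ltW p_gt0)// /pos_part.
  by case: (leP (Dbar - u) 0); case: (leP (y - u) 0); lra.
by case: (leP (u - Dbar) 0); case: (leP (u - y) 0); lra.
Qed.

Lemma minimum_ge0 : 0 <= v.
Proof.
have [s sD sP] := expected_minimum_attained h_gt0 p_gt0 Dbar_gt0 PD.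
rewrite /v (minimumE sD sP) /g (expected_period_cost_interval PD)//.
by apply: Rintegral_ge0 => u _; exact: period_cost_ge0.
Qed.

Section independent_order.
Variables (d : measure_display) (Omega : measurableType d).
Variables (Pr : probability Omega R) (n : nat) (X : nat -> {RV Pr >-> R}).
Hypothesis iidX : iid n X P.

(** By independence the joint law of level and demand is a product, so integrating the demand first
    leaves the mean of [g] at the nonnegative level, where [g] is at least [v]. *)
Lemma independent_order_cost (t : 'I_n) (Y : Omega -> R) :
  measurable_fun setT (Y : Omega -> measurableTypeR R) -> (forall w, 0 <= Y w) ->
  (forall S : set R, measurable S -> <<s past_box X t >> (Y @^-1` S)) ->
  (v%:E <= \int[Pr]_w (period_cost h p (Y w) (X t w))%:E)%E.
Proof.
move=> mY Y0 sY; have [ind law] := iidX.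
pose YY : {mfun Omega >-> measurableTypeR R} := HB.pack Y (isMeasurableFun.Build _ _ _ _ _ mY).
have mZ : measurable_fun setT (fun w => (Y w : measurableTypeR R, X t w : measurableTypeR R)).
  by apply: measurable_fun_pair => //; exact: (measurable_funP (X t)).
pose ZZ : {mfun Omega >-> (measurableTypeR R * measurableTypeR R)%type} :=
  HB.pack (fun w => (Y w : measurableTypeR R, X t w : measurableTypeR R))
    (isMeasurableFun.Build _ _ _ _ _ mZ).
pose c (z : measurableTypeR R * measurableTypeR R) := (period_cost h p z.1 z.2)%:E.
have mc : measurable_fun setT c.
  by apply/measurable_EFinP; apply: measurable_period_cost.
have c0 z : (0 <= c z)%E by rewrite lee_fin period_cost_ge0.
have joint S : measurable S -> (distribution Pr YY \x P)%E S = distribution Pr ZZ S.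
  apply: product_measure_unique => A B mA mB.
  rewrite -[LHS]/(Pr (Y @^-1` A `&` X t @^-1` B)).
  rewrite (past_present_independent ind sY mA mB); congr (_ * _)%E.
  exact: (law t B mB).
rewrite -[leRHS]/(\int[Pr]_w (c \o ZZ) w)%E -ge0_integral_distribution//.
rewrite -(eq_measure_integral _ (fun S mS _ => joint S mS)) fubini_tonelli1//.
rewrite ge0_integral_distribution//; last 2 first.
- exact: measurable_fun_fubini_tonelli_F.
- by move=> y; apply: integral_ge0.
rewrite -[leLHS]mule1 -(probability_setT Pr) -integral_cst//.
apply: ge0_le_integral => //.
- by move=> w _; rewrite lee_fin minimum_ge0.
- apply: measurableT_comp => //; exact: measurable_fun_fubini_tonelli_F.
- by move=> w _; rewrite /= /fubini_F integral_period_cost lee_fin minimum_le_expected.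
Qed.

End independent_order.
End newsvendor.

(** * The base-stock policy *)

Section base_stock.
Variables (R : realType) (s : R).

(** The inner maximum makes the policy feasible at every state and for every real [s]. *)
Definition base_stock_level (t : nat)
  (q : (unit * history R t * measurableTypeR R)%type) : R := Num.max s (Num.max q.2 0).

Lemma measurable_base_stock_level t : measurable_fun setT (@base_stock_level t).
Proof.
by apply: measurable_maxr => //; apply: measurable_maxr => //; exact: measurable_snd.
Qed.

Lemma base_stock_feasible t (z : unit) (H : history R t) (x : R) :
  Num.max x 0 <= base_stock_level (z, H, x).
Proof. by rewrite le_max lexx orbT. Qed.

Definition base_stock : policy R :=
  @Policy R _ unit (dirac tt) base_stock_level measurable_base_stock_level base_stock_feasible.

(** Demand is nonnegative, so an inventory at most [s] stays so; the empty start provides the base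
    case. *)
Lemma base_stock_state (m : dynamics) (i : information) (z : seed base_stock)
    (u : nat -> R) (t : nat) : 0 <= s -> (forall j, (j < t)%N -> 0 <= u j) ->
  (trajectory m i 0 z u t).2 <= s.
Proof.
move=> s0; elim: t => [//|t IH] u0; rewrite trajectoryS /= order_up_toE /=.
have xs := IH (fun j jt => u0 j (ltnW jt)).
rewrite /base_stock_level/= max_l; last by rewrite ge_max xs s0.
have ut := u0 t (ltnSn t).
by clear IH xs; case: m => /=; rewrite ?/pos_part ?ge_max ?s0 ?andbT; lra.
Qed.

Lemma base_stock_order (m : dynamics) (i : information) (z : seed base_stock)
    (u : nat -> R) (t : nat) : 0 <= s -> (forall j, (j < t)%N -> 0 <= u j) ->
  order_up_to m i 0 z u t = s.
Proof.
move=> s0 u0; rewrite order_up_toE/= /base_stock_level/= max_l//.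
by rewrite ge_max s0 base_stock_state.
Qed.

End base_stock.

Section value.
Variables (R : realType) (h p Dbar : R) (P : probability (measurableTypeR R) R).
Hypotheses (h_gt0 : 0 < h) (p_gt0 : 0 < p) (Dbar_gt0 : 0 < Dbar).
Hypothesis PD : P `[0, Dbar]%classic = 1%E.
Variables (T : nat) (m : dynamics) (i : information).
Variables (d : measure_display) (Omega : measurableType d).
Variables (Pr : probability Omega R) (X : nat -> {RV Pr >-> R}).
Hypothesis iidX : iid T X P.

Let v := minimum Dbar (expected_period_cost h p P).

Let stage (pi : policy R) (t : nat) (w : Omega * seed pi) : \bar R :=
  (period_cost h p (order_up_to m i 0 w.2 (fun j => X j w.1) t) (X t w.1))%:E.

Let stage_ge0 pi t w : (0 <= @stage pi t w)%E.
Proof. by rewrite lee_fin period_cost_ge0. Qed.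

Let measurable_stage pi t : measurable_fun setT (@stage pi t).
Proof.
have mX j : measurable_fun setT (fun w : Omega * seed pi => X j w.1).
  by apply: (@measurableT_comp _ _ _ _ _ _ (X j)).
apply/measurable_EFinP; apply: measurable_period_cost => //.
exact: (@measurable_order_up_to R m i pi 0 _ (Omega * seed pi)%type snd
  (fun j w => X j w.1) measurable_snd t (fun j _ => mX j)).
Qed.

(** The seed is made the outer variable: once it is fixed, the policy is deterministic and the inner
    integral concerns the demands alone. *)
Let expected_total_costE pi : expected_total_cost h p m i T X 0 pi =
  (\sum_(t < T) \int[seed_law pi]_z \int[Pr]_w stage t (w, z))%E.
Proof.
transitivity (\sum_(t < T) \int[Pr \x seed_law pi]_w @stage pi t w)%E.
  rewrite -ge0_integral_sum// /expected_total_cost unlock.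
  by apply: eq_integral => w _; rewrite /total_cost -sumEFin.
by apply: eq_bigr => t _; rewrite fubini_tonelli2.
Qed.

Lemma expected_total_cost_ge pi : ((T%:R * v)%:E <= expected_total_cost h p m i T X 0 pi)%E.
Proof.
rewrite expected_total_costE -[T in T%:R * v]card_ord mulr_natl -sumr_const -sumEFin.
apply: lee_sum => t _.
rewrite -[leLHS]mule1 -(probability_setT (seed_law pi)) -integral_cst//.
apply: ge0_le_integral => //.
- by move=> z _; rewrite lee_fin (minimum_ge0 h_gt0 p_gt0 Dbar_gt0 PD).
- exact: measurable_fun_fubini_tonelli_G.
move=> z _; apply: (independent_order_cost h_gt0 p_gt0 Dbar_gt0 PD iidX).
- apply: (@measurable_order_up_to R m i pi 0 _ Omega (cst z) (fun j w => X j w)).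
    exact: measurable_cst.
  by move=> j _; exact: measurable_funP.
- move=> w; rewrite order_up_toE; apply: le_trans (@level_feasible R pi t _ _ _).
  by rewrite le_max lexx orbT.
(* The level is adapted: [measurable_order_up_to] is applied with the past sigma-algebra as the
   measurable structure of [Omega]. *)
- move=> S mS.
  have := @measurable_order_up_to R m i pi 0 _ (g_sigma_algebraType (past_box X t))
    (cst z) (fun j w => X j w) (measurable_cst _) t _ measurableT S mS.
  rewrite setTI; apply=> j jt _ A mA; rewrite setTI; apply: sub_sigma_algebra.
  exists (fun k => if k == j then A else setT); first by move=> k; case: ifP.
  apply/seteqP; split => w /= Aw; first by move=> k kt; case: eqP => // ->.
  by have := Aw j jt; rewrite eqxx.
Qed.

Lemma expected_total_cost_base_stock s : 0 <= s -> expected_period_cost h p P s = v ->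
  expected_total_cost h p m i T X 0 (base_stock s) = (T%:R * v)%:E.
Proof.
move=> s0 gs; rewrite expected_total_costE -[T in T%:R * v]card_ord mulr_natl.
rewrite -sumr_const -sumEFin; apply: eq_bigr => t _.
have [mN N0] := outside_interval_null PD iidX.
have mc : measurable_fun setT (fun u : measurableTypeR R => (period_cost h p s u)%:E).
  apply/measurable_EFinP; apply: measurable_period_cost.
    exact: measurable_cst.
  exact: measurable_id.
have E z : (\int[Pr]_w @stage (base_stock s) t (w, z) = v%:E)%E.
  (* Demands are nonnegative only almost surely; off the null event the order level is exactly
     [s]. *)
  rewrite (ge0_negligible_integral mN)//; last first.
    by apply: (measurableT_comp (@measurable_stage (base_stock s) t)).
  transitivity (\int[Pr]_(w in setT `\` outside_interval T Dbar X)
     (period_cost h p s (X t w))%:E)%E.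
    apply: eq_integral => w; rewrite inE => -[_ nw].
    rewrite /stage/= base_stock_order// => j jt.
    move/negP: nw; rewrite negb_exists => /forallP/(_ (Ordinal (ltn_trans jt (ltn_ord t)))).
    by rewrite negbK => /andP[].
  rewrite -(ge0_negligible_integral mN)//; last 2 first.
  - by apply: (measurableT_comp mc); exact: (measurable_funP (X t)).
  - by move=> w _; rewrite lee_fin period_cost_ge0.
  rewrite -gs -(integral_period_cost h_gt0 p_gt0 PD).
  have mX : measurable_fun setT (X t : Omega -> measurableTypeR R).
    exact: (measurable_funP (X t)).
  pose XX : {mfun Omega >-> measurableTypeR R} :=
    HB.pack (X t : Omega -> measurableTypeR R) (isMeasurableFun.Build _ _ _ _ _ mX).
  have := @ge0_integral_distribution _ _ _ _ _ Pr XX _ mc.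
  move=> <-; last by move=> u; rewrite lee_fin period_cost_ge0.
  by have [_ law] := iidX; apply: eq_measure_integral => A mA _; exact: (law t).
rewrite (eq_integral (cst v%:E)) => [|z _]; last exact: E.
rewrite integral_cst// [X in (_ * X)%E](_ : _ = 1%E) ?mule1//.
exact: (probability_setT (seed_law (base_stock s))).
Qed.

Lemma optimal_costE : optimal_cost h p m i T X 0 = (T%:R * v)%:E.
Proof.
apply/eqP; rewrite eq_le; apply/andP; split.
  have [s sD sP] := expected_minimum_attained h_gt0 p_gt0 Dbar_gt0 PD.
  apply: ereal_inf_lbound; exists (base_stock s); apply/esym.
  apply: expected_total_cost_base_stock; last by rewrite /v (minimumE sD sP).
  by move: sD; rewrite in_itv/= => /andP[].
by apply: le_ereal_inf_tmp => _ [pi ->]; exact: expected_total_cost_ge.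
Qed.

End value.

(** * Sample size *)

Lemma ereal_dist_set (R : realType) (U : Type) (f : U -> R) (a b : R) :
  [set w | (`|(f w)%:E - a%:E| <= b%:E)%E] = [set w | `|f w - a| <= b].
Proof. by apply/seteqP; split => w. Qed.

Lemma sample_size_suffices (R : realType) (T M : nat) (c eps eta : R) :
  0 <= c -> 0 < eps -> 0 < eta < 1 -> (0 < M)%N ->
  T%:R ^+ 2 * c ^+ 2 * ln (2 / eta) / (2 * eps ^+ 2) <= M%:R ->
  T%:R * c * Num.sqrt (ln (2 / eta) / (2 * M%:R)) <= eps.
Proof.
move=> c0 eps0 /andP[eta0 eta1] M0 HM.
have ln0 : 0 < ln (2 / eta) by rewrite ln_gt0// ltr_pdivlMr//; lra.
have MR : 0 < M%:R :> R by rewrite ltr0n.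
have q0 : 0 <= ln (2 / eta) / (2 * M%:R) by rewrite divr_ge0 ?mulr_ge0// ltW.
rewrite -(@ler_pXn2r _ 2)// ?nnegrE; [|by rewrite !mulr_ge0 ?sqrtr_ge0|exact: ltW].
rewrite exprMn sqr_sqrtr// exprMn mulrA ler_pdivrMr ?mulr_gt0//.
by move: HM; rewrite ler_pdivrMr ?mulr_gt0 ?exprn_gt0//; lra.
Qed.

(** The [+ 1] pays for rounding up the sample size. As [eta <= eta0 < 1], [ln (1 / eta)] stays above
    [l0 > 0], so the constant [ln 2] is absorbed; [eps <= eps0] and [1 <= T] then absorb the
    [+ 1]. *)
Lemma sample_size_order (R : realType) (c eps0 eta0 : R) :
  0 < eps0 -> 0 < eta0 < 1 ->
  exists C : R, forall (T : nat) (eps eta : R),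
    (0 < T)%N -> 0 < eps <= eps0 -> 0 < eta <= eta0 ->
    T%:R ^+ 2 * c ^+ 2 * ln (2 / eta) / (2 * eps ^+ 2) + 1 <=
    C * (T%:R ^+ 2 * eps ^- 2 * ln (1 / eta)).
Proof.
move=> e0 /andP[h0 h1]; set l0 := ln (1 / eta0).
have l0_gt0 : 0 < l0 by rewrite ln_gt0// ltr_pdivlMr//; lra.
exists (c ^+ 2 / 2 * (ln 2 / l0 + 1) + eps0 ^+ 2 / l0).
move=> T eps eta T0 /andP[ep0 ep1] /andP[et0 et1].
set l := ln (1 / eta).
have ll0 : l0 <= l.
  by rewrite ler_ln ?posrE ?divr_gt0// !div1r lef_pV2.
have lE : ln (2 / eta) = ln 2 + l by rewrite -lnM ?posrE ?divr_gt0// mulrA mulr1.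
have ln2_ge0 : 0 <= ln 2 :> R by rewrite ln_ge0//; lra.
have lle : ln (2 / eta) <= (ln 2 / l0 + 1) * l.
  rewrite lE mulrDl mul1r lerD2r mulrAC ler_pdivlMr// ler_wpM2l//.
set t := T%:R ^+ 2 * eps ^- 2.
have t0 : 0 <= t by rewrite mulr_ge0 ?exprn_ge0 ?invr_ge0 ?exprn_ge0// ltW.
have epn : eps != 0 by rewrite gt_eqF.
have -> : T%:R ^+ 2 * c ^+ 2 * ln (2 / eta) / (2 * eps ^+ 2) = c ^+ 2 / 2 * (t * ln (2 / eta)).
  by rewrite /t; field.
rewrite [leRHS]mulrDl lerD//.
  rewrite -[leRHS]mulrA ler_wpM2l ?divr_ge0 ?sqr_ge0//.
  by rewrite [leRHS]mulrCA ler_wpM2l.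
have one : 1 <= eps0 ^+ 2 * t.
  rewrite /t mulrCA -[leLHS]mulr1 ler_pM//.
    by rewrite exprn_ege1// ler1n.
  by rewrite ler_pdivlMr ?exprn_gt0// mul1r; apply: lerXn2r => //; rewrite nnegrE ltW.
have : 1 <= l / l0 by rewrite ler_pdivlMr// mul1r.
have -> : eps0 ^+ 2 / l0 * (t * l) = (eps0 ^+ 2 * t) * (l / l0) by ring.
by move=> ?; rewrite -[leLHS]mulr1 ler_pM.
Qed.

Theorem mainTheorem15 (R : realType) :
  (forall (h p Dbar : R) (P : probability (measurableTypeR R) R) (T : nat)
      (m : dynamics) (i : information)
      (d : measure_display) (Omega : measurableType d)
      (Pr : probability Omega R) (demand : nat -> {RV Pr >-> R}),
    0 < h -> 0 < p -> 0 < Dbar -> P `[0, Dbar]%classic = 1%E -> (0 < T)%N ->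
    iid T demand P ->
    [/\ minimum_attained Dbar (expected_period_cost h p P),
        optimal_cost h p m i T demand 0 =
          (T%:R * minimum Dbar (expected_period_cost h p P))%:E
      & forall (M : nat) (d' : measure_display) (Omega' : measurableType d')
          (Pr' : probability Omega' R) (sample : nat -> {RV Pr' >-> R}),
        (0 < M)%N -> iid M sample P ->
        (forall w : Omega', minimum_attained Dbar
          (empirical_period_cost h p M (fun j => sample j w))) /\
        forall eta : R, 0 < eta < 1 ->
        with_probability_at_least Pr' (1 - eta)
          [set w | (`|(empirical_cost h p Dbar T M (fun j => sample j w))%:E
                      - optimal_cost h p m i T demand 0|
                    <= (T%:R * Num.max h p * Dbar
                        * Num.sqrt (ln (2 / eta) / (2 * M%:R)))%:E)%E]]) /\
  (forall cost_scale demand_scale eps0 eta0 : R,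
    0 < cost_scale -> 0 < demand_scale -> 0 < eps0 -> 0 < eta0 < 1 ->
    exists (C : R) (N : nat -> R -> R -> nat),
    forall (T : nat) (eps eta : R),
      (0 < T)%N -> 0 < eps <= eps0 -> 0 < eta <= eta0 ->
      [/\ (0 < N T eps eta)%N,
          (N T eps eta)%:R <= C * (T%:R ^+ 2 * eps ^- 2 * ln (1 / eta))
        & forall (h p Dbar : R) (P : probability (measurableTypeR R) R)
            (m : dynamics) (i : information)
            (d : measure_display) (Omega : measurableType d)
            (Pr : probability Omega R) (demand : nat -> {RV Pr >-> R})
            (M : nat) (d' : measure_display) (Omega' : measurableType d')
            (Pr' : probability Omega' R) (sample : nat -> {RV Pr' >-> R}),
          0 < h <= cost_scale -> 0 < p <= cost_scale ->
          0 < Dbar <= demand_scale -> P `[0, Dbar]%classic = 1%E ->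
          iid T demand P -> (N T eps eta <= M)%N -> iid M sample P ->
          with_probability_at_least Pr' (1 - eta)
            [set w | (`|(empirical_cost h p Dbar T M (fun j => sample j w))%:E
                        - optimal_cost h p m i T demand 0| <= eps%:E)%E]]).
Proof.
split.
  move=> h p Dbar P T m i d Omega Pr demand h0 p0 D0 PD T0 iidD; split.
  - exact: expected_minimum_attained PD.
  - exact: (optimal_costE h0 p0 D0 PD m i iidD).
  - move=> M d' Omega' Pr' sample M0 iidS; split.
      by move=> w; exact: empirical_minimum_attained.
    move=> eta eta01; rewrite (optimal_costE h0 p0 D0 PD m i iidD) ereal_dist_set.
    exact: (empirical_cost_concentration h0 p0 D0 M0 PD iidS).
move=> cs ds eps0 eta0 cs0 ds0 e0 eta01.
have [C HC] := @sample_size_order R (cs * ds) eps0 eta0 e0 eta01.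
pose B (T : nat) (eps eta : R) :=
  T%:R ^+ 2 * (cs * ds) ^+ 2 * ln (2 / eta) / (2 * eps ^+ 2).
(* [B] is the size at which the radius equals [eps] for the largest admissible scales; its
   truncation plus one lies between [B] and [B + 1] and is positive. *)
exists C, (fun T eps eta => (Num.truncn (B T eps eta)).+1).
move=> T eps eta T0 eps01 etal.
have eta1 : 0 < eta < 1.
  by move: eta01 etal => /andP[_ lt1] /andP[-> le0]; exact: le_lt_trans lt1.
have ln0 : 0 < ln (2 / eta).
  by case/andP: eta1 => ? ?; rewrite ln_gt0// ltr_pdivlMr//; lra.
have B0 : 0 <= B T eps eta.
  apply: divr_ge0; last by apply: mulr_ge0 => //; exact: sqr_ge0.
  by apply: mulr_ge0; [apply: mulr_ge0; exact: sqr_ge0|exact: ltW].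
split=> //.
  apply: le_trans (HC T eps eta T0 eps01 etal); rewrite -natr1 lerD2r.
  by case/andP: (truncn_itv B0).
move=> h p Dbar P m i d Omega Pr demand M d' Omega' Pr' sample.
move=> /andP[h0 hcs] /andP[p0 pcs] /andP[D0 Dds] PD iidD NM iidS.
have M0 : (0 < M)%N by exact: leq_trans NM.
rewrite (optimal_costE h0 p0 D0 PD m i iidD) ereal_dist_set.
apply: (empirical_cost_concentration h0 p0 D0 M0 PD iidS) => //.
have eps_gt0 : 0 < eps by case/andP: eps01.
have BM : B T eps eta <= M%:R.
  by apply: le_trans (ltW (truncnS_gt _)) _; rewrite ler_nat.
apply: le_trans (sample_size_suffices (ltW (mulr_gt0 cs0 ds0)) eps_gt0 eta1 M0 BM).
rewrite ler_wpM2r ?sqrtr_ge0// -mulrA ler_wpM2l//.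
by rewrite ler_pM ?(ltW D0)//; rewrite ?le_max ?ge_max ?(ltW h0) ?hcs.
Qed.
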